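(* For $t,t_w\ge 0$ define $$\Pi(t,t_w):=\frac{1}{2\pi i}\int_\gamma\frac{e^{-t_w\lambda}}{\lambda}\,\frac{\mathbb{E}_x\!\left(\frac{e^{-xt}}{\lambda-x}\right)}{\mathbb{E}_x\!\left(\frac{1}{\lambda-x}\right)}\,d\lambda,$$ where $\mathbb{E}_x$ is the expectation with respect to the probability measure $\alpha x^{\alpha-1}\,dx$ on $[0,1]$ and $\gamma$ is any positively oriented complex loop around the interval $[0,1]$. Then, for almost all realizations of $\underline{E}$, $$\lim_{N\uparrow\infty}\Pi_N(t,t_w)=\Pi(t,t_w)\qquad\text{for all } t,t_w .$$
   Context: Fix $0<\alpha<1$. Let $\underline{E}=\{E_i:i\in\mathbb{N}\}$ be a family of i.i.d. exponentially distributed random variables with parameter $\alpha$, and set $x_i=e^{-E_i}$ (so $x_i$ has density $\alpha x^{\alpha-1}$ on $(0,1]$). Given a realization of $\underline{E}$ and $N\in\mathbb{N}$, let $Y_N(t)$, $t\ge0$, be the continuous-time Markov chain on $\{1,\dots,N\}$ with jump rate $x_i/N$ from $i$ to $j$ for every $j\ne i$, started from the uniform distribution; $\mathbb{P}_N$ denotes its law for the given realization of $\underline{E}$. Define $$\Pi_N(t,t_w):=\mathbb{P}_N\big(Y_N(s)=Y_N(t_w)\ \ \forall s\in[t_w,t_w+t]\big).$$ *)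

(* Defs.v *)
From HB Require Import structures.
From mathcomp Require Import all_boot all_order all_algebra.
From mathcomp Require Import complex.
From mathcomp Require Import all_classical all_reals all_analysis.
Set Implicit Arguments.
Unset Strict Implicit.
Unset Printing Implicit Defensive.
Import Order.TTheory GRing.Theory Num.Theory.
Import numFieldNormedType.Exports.
Local Open Scope classical_set_scope.
Local Open Scope ring_scope.
Local Open Scope complex_scope.

Definition mutually_independent (R : realType) (d : measure_display)
    (T : measurableType d) (P : probability T R)
    (X : nat -> {RV P >-> R}) : Prop :=
  forall (J : seq nat) (A : nat -> set R),
    uniq J -> (forall j, measurable (A j)) ->
    P (\big[setI/setT]_(j <- J) (X j @^-1` A j)) =
    (\prod_(j <- J) P (X j @^-1` A j))%E.

Definition expmx (R : realType) (n : nat) (A : 'M[R]_n) : 'M[R]_n :=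
  lim (series (fun k => k`!%:R^-1 *: A ^+ k) @ \oo).

(* [r i j] is the rate of the jumps from [i] to [j] for [j != i]; the diagonal
   of [r] is ignored. *)
Definition rate_generator (R : realType) (n : nat)
    (r : 'I_n -> 'I_n -> R) : 'M[R]_n :=
  \matrix_(i, j) if i == j then - \sum_(k | k != i) r i k else r i j.

(* A process with right-continuous paths (for the discrete topology on the
   states) whose finite-dimensional distributions are those of the Markov chain
   with initial law [mu0] and transition semigroup [expmx (t *: Q)], where [Q]
   is the generator with jump rates [r]. Only the times [0 <= t] are
   meaningful. *)
Definition is_markov_chain (R : realType) (d : measure_display)
    (T : measurableType d) (P : probability T R) (n : nat)
    (mu0 : 'I_n -> R) (r : 'I_n -> 'I_n -> R) (Y : R -> T -> 'I_n) : Prop :=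
  [/\ forall t i, 0 <= t -> measurable (Y t @^-1` [set i]),
      forall w t, 0 <= t -> \forall s \near t^'+, Y s w = Y t w &
      forall (m : nat) (t : nat -> R) (i : nat -> 'I_n),
        t 0%N = 0 -> {homo t : a b / (a <= b)%N >-> a <= b} ->
        P [set w | forall k, (k <= m)%N -> Y (t k) w = i k] =
        (mu0 (i 0%N) *
         \prod_(k < m) expmx ((t k.+1 - t k) *: rate_generator r)
                         (i k) (i k.+1))%:E].

(* The chain on [N.+1] states; the states are numbered from 0. *)
Definition trap_rate (R : realType) (x : nat -> R) (N : nat)
    (i j : 'I_N.+1) : R := x i / N.+1%:R.

Definition uniform_law (R : realType) (N : nat) (i : 'I_N.+1) : R :=
  N.+1%:R^-1.

Definition stay_probability (R : realType) (d : measure_display)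
    (T : measurableType d) (P : probability T R) (n : nat)
    (Y : R -> T -> 'I_n) (t tw : R) : R :=
  fine (P [set w | forall s, tw <= s <= tw + t -> Y s w = Y tw w]).

Definition cexp (R : realType) (z : R[i]) : R[i] :=
  (expR (complex.Re z))%:C * (cos (complex.Im z) +i* sin (complex.Im z)).

Definition cintegral (R : realType) (D : set R) (f : R -> R[i]) : R[i] :=
  (\int[lebesgue_measure]_(x in D) complex.Re (f x)) +i*
  (\int[lebesgue_measure]_(x in D) complex.Im (f x)).

Definition power_expectation (R : realType) (alpha : R)
    (f : R -> R[i]) : R[i] :=
  cintegral `[0, 1] (fun x => (alpha * x `^ (alpha - 1))%:C * f x).

Definition piecewise_C1 (R : realType) (h : R -> R) : Prop :=
  {within `[0, 1], continuous h} /\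
  exists s : seq R,
    [/\ path <%R 0 s, last 0 s = 1 &
        forall k, (k < size s)%N ->
          let a := nth 0 (0 :: s) k in let b := nth 0 s k in
          exists dh : R -> R,
            {within `[a, b], continuous dh} /\
            {in `]a, b[, forall u : R, is_derive u (1 : R) h (dh u)}].

Definition cderive (R : realType) (g : R -> R[i]) (s : R) : R[i] :=
  (fun u => complex.Re (g u))^`()%classic s +i*
  (fun u => complex.Im (g u))^`()%classic s.

(* For a piecewise C1 path [g], [cderive g] is the derivative except at finitely
   many points, which do not contribute to the integral. *)
Definition contour_integral (R : realType) (g : R -> R[i])
    (f : R[i] -> R[i]) : R[i] :=
  cintegral `[0, 1] (fun s => f (g s) * cderive g s).

Definition two_pi_i (R : realType) : R[i] := 0 +i* (2 * pi).

Definition winding_number (R : realType) (g : R -> R[i]) (a : R[i]) : R[i] :=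
  (two_pi_i R)^-1 * contour_integral g (fun z => (z - a)^-1).

(* The closed paths, simple or not, in the complement of the interval [0, 1]
   that wind once counterclockwise around it. *)
Definition positive_loop_around01 (R : realType) (g : R -> R[i]) : Prop :=
  [/\ piecewise_C1 (fun s => complex.Re (g s)),
      piecewise_C1 (fun s => complex.Im (g s)),
      g 0 = g 1,
      {in `[0, 1] & `[0, 1], forall s x : R, g s != x%:C} &
      {in `[0, 1], forall x : R, winding_number g x%:C = 1}].

Definition limit_Pi (R : realType) (alpha : R) (g : R -> R[i])
    (t tw : R) : R[i] :=
  (two_pi_i R)^-1 *
  contour_integral g (fun lambda =>
    cexp (- (tw%:C * lambda)) / lambda *
    (power_expectation alpha
       (fun x => (expR (- (x * t)))%:C / (lambda - x%:C)) /
     power_expectation alpha (fun x => (lambda - x%:C)^-1))).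

(* Main.v *)
Require Import Defs.
From mathcomp Require Import all_boot all_order all_algebra.
From mathcomp Require Import complex.
From mathcomp Require Import all_classical all_reals all_analysis.
From mathcomp Require Import measurable_realfun.
From mathcomp Require Import sesquilinear spectral.
From mathcomp Require Import ring lra.

(** Fix a realization of the traps x_i, put n = N + 1 and let mu_n be the empirical
    measure of x_0, ..., x_N. The generator of the chain is Q = D (J - 1), where D is
    the diagonal matrix of the x_i and J has all its entries equal to 1/n.

    The formula of the theorem is exact for every N, with mu_n in place of the law
    of x. By the Markov property and right continuity ([stay_probabilityE]) Pi_N is
    the mean over the starting state of exp(tw Q) v, with v_i = exp(- x_i t N/(N + 1)),
    the last factor being the probability of not leaving i. The matrix - Q is similar
    to the Hermitian matrix D^(1/2) (1 - J) D^(1/2), whose eigenvalues l_j lie in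
    [0, 1] because J is an orthogonal projection ([generator_spectral]). Hence
    Pi_N = sum_j w_j exp(- tw l_j), and the mean of the resolvent (z + Q)^-1 v is
    sum_j w_j / (z - l_j). On the other hand Q is a rank one perturbation of - D, so
    that this mean is computed by hand: it is
    mu_n(v / (z - x)) / (z mu_n(1 / (z - x))) ([trap_resolvent], [trap_semigroup]).
    It remains to know that the integral of exp(- s z) / (z - a) along the loop is
    2 pi i exp(- s a) for a in [0, 1] ([loop_cexp_subV]). For polynomials in place of
    the exponential this follows from the winding number and from the fundamental
    theorem of calculus along the loop, and exp(- s z) is the bounded limit of the
    polynomials (1 - s z/m)^m. As all the poles l_j lie in [0, 1], the winding
    numbers of the loop evaluate the whole integral; this gives [mean_stayE].

    Then N tends to infinity. Almost surely, for all u in a countable dense set, the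
    frequency of the traps that are at least u tends to 1 - u^alpha
    ([frequency_cvg], [ae_traps]); hence the means under mu_n of Lipschitz functions
    converge to their integrals under the power law ([empirical_average_cvg]). For z
    on the loop this applies to the numerator and to the denominator of the ratio.
    The loop is at a positive distance from [0, 1], and for z off [0, 1] the numbers
    1 / (z - x), x in [0, 1], lie in a half-plane away from 0
    ([empirical_resolvent_ge]). So the denominators are bounded below uniformly in N,
    and the bounded convergence theorem on the loop concludes
    ([contour_integrand_cvg]). *)

Set Implicit Arguments.
Unset Strict Implicit.
Unset Printing Implicit Defensive.
Import Order.TTheory GRing.Theory Num.Theory.
Import numFieldNormedType.Exports.
Local Open Scope classical_set_scope.
Local Open Scope ring_scope.
Local Open Scope complex_scope.
Local Notation Re := complex.Re.
Local Notation Im := complex.Im.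
Local Notation normc := (@Normc.normc _).

(** * Complex numbers and their coordinates *)

Section complex_numbers.
Context {R : realType}.
Implicit Types (z w : R[i]) (x y : R).

Lemma cReD z w : Re (z + w) = Re z + Re w. Proof. by case: z w => [? ?] []. Qed.
Lemma cImD z w : Im (z + w) = Im z + Im w. Proof. by case: z w => [? ?] []. Qed.
Lemma cReN z : Re (- z) = - Re z. Proof. by case: z. Qed.
Lemma cImN z : Im (- z) = - Im z. Proof. by case: z. Qed.
Lemma cReB z w : Re (z - w) = Re z - Re w. Proof. by rewrite cReD cReN. Qed.
Lemma cImB z w : Im (z - w) = Im z - Im w. Proof. by rewrite cImD cImN. Qed.
Lemma cReM z w : Re (z * w) = Re z * Re w - Im z * Im w.
Proof. by case: z w => [? ?] []. Qed.
Lemma cImM z w : Im (z * w) = Re z * Im w + Im z * Re w.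
Proof. by case: z w => [? ?] [? ?] /=. Qed.
Lemma cReV z : Re z^-1 = Re z / (Re z ^+ 2 + Im z ^+ 2). Proof. by case: z. Qed.
Lemma cImV z : Im z^-1 = - Im z / (Re z ^+ 2 + Im z ^+ 2).
Proof. by case: z => a b /=; rewrite mulNr. Qed.
Lemma cRe_sum I (r : seq I) (p : pred I) (F : I -> R[i]) :
  Re (\sum_(i <- r | p i) F i) = \sum_(i <- r | p i) Re (F i).
Proof. by elim/big_rec2: _ => // i x y _ <-; rewrite cReD. Qed.
Lemma cIm_sum I (r : seq I) (p : pred I) (F : I -> R[i]) :
  Im (\sum_(i <- r | p i) F i) = \sum_(i <- r | p i) Im (F i).
Proof. by elim/big_rec2: _ => // i x y _ <-; rewrite cImD. Qed.

Lemma normCE z : `|z| = (normc z)%:C. Proof. by []. Qed.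
Lemma normc_sqrtE z : normc z = Num.sqrt (Re z ^+ 2 + Im z ^+ 2).
Proof. by case: z. Qed.
Lemma normc_ge0 z : 0 <= normc z. Proof. by rewrite normc_sqrtE sqrtr_ge0. Qed.
Lemma normcR x : normc x%:C = `|x|.
Proof. by rewrite normc_sqrtE /= expr0n addr0 sqrtr_sqr. Qed.
Lemma ler_normc_Re z : `|Re z| <= normc z.
Proof. by rewrite -lecR; exact: normc_ge_Re. Qed.
Lemma ler_normc_Im z : `|Im z| <= normc z.
Proof.
rewrite normc_sqrtE -sqrtr_sqr ler_wsqrtr// lerDr sqr_ge0//. Qed.
Lemma ler_normcD z w : normc (z + w) <= normc z + normc w.
Proof. exact: le_normcD. Qed.
Lemma normcM z w : normc (z * w) = normc z * normc w.
Proof. exact: Normc.normcM. Qed.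
Lemma normcV z : normc z^-1 = (normc z)^-1.
Proof. exact: Normc.normcV. Qed.
Lemma normcX z n : normc (z ^+ n) = normc z ^+ n.
Proof. by elim: n => [|n ih]; rewrite ?Normc.normc1// !exprS normcM ih. Qed.
Lemma ler_normc_ReIm z : normc z <= `|Re z| + `|Im z|.
Proof.
rewrite {1}(complexE z); apply: (le_trans (ler_normcD _ _)).
by rewrite normcM !normcR lerD2l normc_sqrtE /= expr0n add0r expr1n sqrtr1 mul1r.
Qed.

Lemma cvgC_ReIm (T : Type) (F : set_system T) (FF : Filter F)
  (u : T -> R[i]^o) (l : R[i]) :
  Re (u x) @[x --> F] --> Re l -> Im (u x) @[x --> F] --> Im l -> u @ F --> (l : R[i]^o).
Proof.
move=> /cvgrPdist_lt hr /cvgrPdist_lt hi.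
apply/cvgrPdist_lt => -[e1 e2]; rewrite ltcE /= => /andP[/eqP -> e0].
near=> x; rewrite normCE ltcR.
have h1 : `|Re l - Re (u x)| < e1 / 2 by near: x; apply: hr; rewrite divr_gt0.
have h2 : `|Im l - Im (u x)| < e1 / 2 by near: x; apply: hi; rewrite divr_gt0.
apply: (le_lt_trans (ler_normc_ReIm _)); rewrite cReB cImB.
by rewrite (splitr e1) ltrD.
Unshelve. all: by end_near. Qed.

(** Stated on real coordinates so that the limit theorems of real analysis apply
    directly. *)
Definition ccvg (u : nat -> R[i]) (l : R[i]) :=
  (Re (u n) @[n --> \oo] --> Re l) /\ (Im (u n) @[n --> \oo] --> Im l).

Lemma ccvg_cst l : ccvg (fun=> l) l.
Proof. by split; exact: cvg_cst. Qed.

Lemma ccvgR (u : nat -> R) (l : R) : u @ \oo --> l -> ccvg (fun n => (u n)%:C) l%:C.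
Proof. by move=> ul; split => //=; exact: cvg_cst. Qed.

Lemma ccvgD u v l m : ccvg u l -> ccvg v m -> ccvg (fun n => u n + v n) (l + m).
Proof.
move=> [u1 u2] [v1 v2]; split; rewrite ?cReD ?cImD.
- by under eq_fun do rewrite cReD; exact: cvgD.
- by under eq_fun do rewrite cImD; exact: cvgD.
Qed.

Lemma ccvgM u v l m : ccvg u l -> ccvg v m -> ccvg (fun n => u n * v n) (l * m).
Proof.
move=> [u1 u2] [v1 v2]; split; rewrite ?cReM ?cImM.
- by under eq_fun do rewrite cReM; apply: cvgB; exact: cvgM.
- by under eq_fun do rewrite cImM; apply: cvgD; exact: cvgM.
Qed.

Lemma addr_sqr_neq0 z : z != 0 -> Re z ^+ 2 + Im z ^+ 2 != 0.
Proof.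
apply: contraNN => /eqP h; apply/eqP/Normc.eq0_normc.
by rewrite normc_sqrtE h sqrtr0.
Qed.

Lemma ccvgV u l : l != 0 -> ccvg u l -> ccvg (fun n => (u n)^-1) l^-1.
Proof.
move=> l0 [u1 u2].
have hn : (Re (u n) ^+ 2 + Im (u n) ^+ 2)^-1 @[n --> \oo] -->
    (Re l ^+ 2 + Im l ^+ 2)^-1.
  by apply: cvgV; [exact: addr_sqr_neq0 | apply: cvgD; apply: cvgM].
split; rewrite ?cReV ?cImV.
- by under eq_fun do rewrite cReV; apply: cvgM.
- by under eq_fun do rewrite cImV; apply: cvgM => //; apply: cvgN.
Qed.

Lemma ccvg_sum I (r : seq I) (u : I -> nat -> R[i]) (l : I -> R[i]) :
  (forall i, ccvg (u i) (l i)) ->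
  ccvg (fun n => \sum_(i <- r) u i n) (\sum_(i <- r) l i).
Proof.
move=> ul; elim: r => [|i r ih].
  by under eq_fun do rewrite big_nil; rewrite big_nil; exact: ccvg_cst.
by under eq_fun do rewrite big_cons; rewrite big_cons; exact: ccvgD.
Qed.

Lemma ccvg_normc0 u l : normc (u n - l) @[n --> \oo] --> 0 -> ccvg u l.
Proof.
move=> h; split; apply/cvgrPdist_le => e e0;
  move/cvgrPdist_le : h => /(_ e e0); apply: filterS => n;
  rewrite sub0r normrN ger0_norm ?normc_ge0// => /(le_trans _); apply;
  rewrite distrC -?cReB -?cImB; [exact: ler_normc_Re|exact: ler_normc_Im].
Qed.

Lemma ccvg_unique u l m : ccvg u l -> ccvg u m -> l = m.
Proof.
move=> [u1 u2] [v1 v2]; apply/eqP; rewrite eq_complex.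
by rewrite (cvg_unique _ u1 v1)//= (cvg_unique _ u2 v2)//= !eqxx.
Qed.

Lemma ccvg_normc u l : ccvg u l -> normc (u n) @[n --> \oo] --> normc l.
Proof.
move=> [u1 u2]; under eq_fun do rewrite normc_sqrtE; rewrite normc_sqrtE.
apply: (@cvg_comp _ _ _ (fun n => Re (u n) ^+ 2 + Im (u n) ^+ 2)
  (@Num.sqrt R) _ (nbhs (Re l ^+ 2 + Im l ^+ 2))).
  by apply: cvgD; apply: cvgM.
exact: sqrt_continuous.
Qed.
End complex_numbers.

(** * Bounded measurable complex functions on the unit interval *)

Section bounded_measurable.
Context {R : realType}.
Implicit Types (f g : R -> R[i]) (z w : R[i]).
Local Notation D := (`[0, 1]%classic : set R).
Local Notation mu := (@lebesgue_measure R).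

Definition cbounded f := exists M : R, forall x : R, x \in `[0, 1] -> normc (f x) <= M.

Definition cmeasurable f :=
  measurable_fun D (fun x => Re (f x)) /\ measurable_fun D (fun x => Im (f x)).

Definition cbmeas f := cmeasurable f /\ cbounded f.

Lemma cmeasurableD f g : cmeasurable f -> cmeasurable g ->
  cmeasurable (fun x => f x + g x).
Proof.
move=> [f1 f2] [g1 g2]; split.
- by under [X in measurable_fun _ X]eq_fun do rewrite cReD; apply: measurable_funD.
- by under [X in measurable_fun _ X]eq_fun do rewrite cImD; apply: measurable_funD.
Qed.

Lemma cmeasurableM f g : cmeasurable f -> cmeasurable g ->
  cmeasurable (fun x => f x * g x).
Proof.
move=> [f1 f2] [g1 g2]; split.
- by under [X in measurable_fun _ X]eq_fun do rewrite cReM;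
    apply: measurable_funB; apply: measurable_funM.
- by under [X in measurable_fun _ X]eq_fun do rewrite cImM;
    apply: measurable_funD; apply: measurable_funM.
Qed.

(** The inverse is written as the real power -1, which is total and measurable,
    applied to the squared modulus. *)
Lemma cmeasurableV f : cmeasurable f -> cmeasurable (fun x => (f x)^-1).
Proof.
move=> [f1 f2].
have h : measurable_fun D (fun x => (Re (f x) ^+ 2 + Im (f x) ^+ 2)^-1).
  under [X in measurable_fun _ X]eq_fun do rewrite -powR_inv1 ?addr_ge0 ?sqr_ge0//.
  apply: (measurableT_comp (measurable_powR _)).
  by apply: measurable_funD; exact: measurable_funX.
split.
- by under [X in measurable_fun _ X]eq_fun do rewrite cReV; apply: measurable_funM.
- by under [X in measurable_fun _ X]eq_fun do rewrite cImV;
    apply: measurable_funM => //; apply: measurable_funN.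
Qed.

Lemma cmeasurable_cst z : cmeasurable (fun=> z).
Proof. by split; exact: measurable_cst. Qed.

Lemma cmeasurable_cvg (u : nat -> R -> R[i]) f :
  (forall n, cmeasurable (u n)) ->
  (forall x : R, x \in `[0, 1] -> ccvg (u ^~ x) (f x)) -> cmeasurable f.
Proof.
move=> mu_ uf; split.
- apply: (@measurable_fun_cvg _ _ _ _ (fun n x => Re (u n x))) => [n|x Dx].
    by case: (mu_ n).
  by case: (uf x Dx).
- apply: (@measurable_fun_cvg _ _ _ _ (fun n x => Im (u n x))) => [n|x Dx].
    by case: (mu_ n).
  by case: (uf x Dx).
Qed.

Lemma continuous_cmeasurable f :
  {within `[0, 1], continuous (fun s => Re (f s))} ->
  {within `[0, 1], continuous (fun s => Im (f s))} -> cmeasurable f.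
Proof.
by move=> f1 f2; split; apply: subspace_continuous_measurable_fun.
Qed.

Lemma cbmeas_cst z : cbmeas (fun=> z).
Proof. by split; [exact: cmeasurable_cst|exists (normc z)]. Qed.

Lemma cbmeasD f g : cbmeas f -> cbmeas g -> cbmeas (fun x => f x + g x).
Proof.
move=> [mf [M fM]] [mg [K gK]]; split; first exact: cmeasurableD.
exists (M + K) => x x01; apply: (le_trans (ler_normcD _ _)).
by rewrite lerD ?fM ?gK.
Qed.

Lemma cbmeasM f g : cbmeas f -> cbmeas g -> cbmeas (fun x => f x * g x).
Proof.
move=> [mf [M fM]] [mg [K gK]]; split; first exact: cmeasurableM.
exists (M * K) => x x01; rewrite normcM.
by apply: ler_pM; rewrite ?normc_ge0 ?fM ?gK.
Qed.

Lemma cbmeasX f n : cbmeas f -> cbmeas (fun x => f x ^+ n).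
Proof.
move=> bf; elim: n => [|n ih]; first exact: cbmeas_cst.
by under eq_fun do rewrite exprS; exact: cbmeasM.
Qed.

Lemma cbmeas_sum I (r : seq I) (F : I -> R -> R[i]) :
  (forall i, cbmeas (F i)) -> cbmeas (fun x => \sum_(i <- r) F i x).
Proof.
move=> bF; elim: r => [|i r ih].
  by under eq_fun do rewrite big_nil; exact: cbmeas_cst.
by under eq_fun do rewrite big_cons; exact: cbmeasD.
Qed.

Lemma cbmeasV f (e : R) : 0 < e -> cmeasurable f ->
  (forall x : R, x \in `[0, 1] -> e <= normc (f x)) -> cbmeas (fun x => (f x)^-1).
Proof.
move=> e0 mf fe; split; first exact: cmeasurableV.
exists e^-1 => x x01; rewrite normcV lef_pV2 ?posrE ?fe//.
by apply: lt_le_trans (fe x x01).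
Qed.

Lemma bounded_measurable_integrable (h : R -> R) (M : R) :
  measurable_fun D h -> (forall x : R, x \in `[0, 1] -> `|h x| <= M) ->
  mu.-integrable D (EFin \o h).
Proof.
move=> mh hM; apply: measurable_bounded_integrable => //.
  by rewrite /= lebesgue_measure_itv/= lte_fin ltr01 -EFinD ltry.
by exists M; split => [|y My x Dx] /=; rewrite ?num_real//; apply/ltW/(le_lt_trans (hM x Dx)).
Qed.

Lemma cbmeas_integrable_Re f : cbmeas f -> mu.-integrable D (EFin \o (fun x => Re (f x))).
Proof.
move=> [[mf _] [M fM]]; apply: (bounded_measurable_integrable (M := M)) => // x x01.
exact: le_trans (ler_normc_Re _) (fM _ x01).
Qed.

Lemma cbmeas_integrable_Im f : cbmeas f -> mu.-integrable D (EFin \o (fun x => Im (f x))).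
Proof.
move=> [[_ mf] [M fM]]; apply: (bounded_measurable_integrable (M := M)) => // x x01.
exact: le_trans (ler_normc_Im _) (fM _ x01).
Qed.

Lemma eq_cintegral f g : (forall x : R, x \in `[0, 1] -> f x = g x) ->
  cintegral D f = cintegral D g.
Proof.
move=> fg; rewrite /cintegral; congr (_ +i* _); apply: eq_Rintegral => x;
  by rewrite inE /= => /fg ->.
Qed.

Lemma cintegralD f g : cbmeas f -> cbmeas g ->
  cintegral D (fun x => f x + g x) = cintegral D f + cintegral D g.
Proof.
move=> bf bg; rewrite /cintegral.
under eq_Rintegral do rewrite cReD.
under [X in _ +i* X]eq_Rintegral do rewrite cImD.
rewrite !RintegralD//; [exact: cbmeas_integrable_Im..|exact: cbmeas_integrable_Re|].
exact: cbmeas_integrable_Re.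
Qed.

Lemma cintegralZ z f : cbmeas f ->
  cintegral D (fun x => z * f x) = z * cintegral D f.
Proof.
move=> bf; rewrite /cintegral.
under eq_Rintegral do rewrite cReM.
under [X in _ +i* X]eq_Rintegral do rewrite cImM.
have h1 := cbmeas_integrable_Re bf; have h2 := cbmeas_integrable_Im bf.
have e (r : R) (h : R -> R) : mu.-integrable D (EFin \o h) ->
    mu.-integrable D (EFin \o (fun x => r * h x)).
  by move=> ih; apply: (integrableZl _ r ih).
rewrite RintegralB ?RintegralD ?RintegralZl//; try exact: e.
by case: z => a b /=.
Qed.

Lemma cintegral0 : cintegral D (fun=> 0) = 0.
Proof. by rewrite /cintegral !Rintegral_cst//= !mul0r. Qed.

Lemma cintegral_sum I (r : seq I) (F : I -> R -> R[i]) :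
  (forall i, cbmeas (F i)) ->
  cintegral D (fun x => \sum_(i <- r) F i x) = \sum_(i <- r) cintegral D (F i).
Proof.
move=> bF; elim: r => [|i r ih].
  by under [X in cintegral _ X]eq_fun do rewrite big_nil; rewrite big_nil cintegral0.
under [X in cintegral _ X]eq_fun do rewrite big_cons; rewrite big_cons -ih cintegralD//.
exact: cbmeas_sum.
Qed.

(** Bounded convergence is the only limit theorem needed on the loop: all the
    integrands there are uniformly bounded. *)
Lemma Rintegral_bounded_cvg (u : nat -> R -> R) (h : R -> R) (M : R) :
  (forall n, measurable_fun D (u n)) ->
  (forall n (x : R), x \in `[0, 1] -> `|u n x| <= M) ->
  (forall x : R, x \in `[0, 1] -> u n x @[n --> \oo] --> h x) ->
  (\int[mu]_(x in D) u n x)%R @[n --> \oo] --> (\int[mu]_(x in D) h x)%R.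
Proof.
move=> mu_ uM uh.
have mh : measurable_fun D h by apply: measurable_fun_cvg mu_ _ => x; exact: uh.
have [] := @dominated_convergence _ _ _ mu D (measurable_itv _)
   (fun n => EFin \o u n) (EFin \o h) (EFin \o cst M).
- by move=> n; apply/(@measurable_EFinP _ (measurableTypeR R)); exact: mu_.
- exact/(@measurable_EFinP _ (measurableTypeR R)).
- by apply: aeW => x Dx; apply/cvg_EFin; [exact: nearW|exact: uh].
- by apply: (bounded_measurable_integrable (M := `|M|)).
- by apply: aeW => x n Dx /=; rewrite lee_fin uM.
move=> ih _ h2; apply: fine_cvg.
have -> : (\int[mu]_(x in D) h x)%:E = (\int[mu]_(x in D) (h x)%:E)%E.
  by rewrite /Rintegral fineK//; exact: integrable_fin_num.
exact: h2.
Qed.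

Lemma cintegral_bounded_cvg (u : nat -> R -> R[i]) f (M : R) :
  (forall n, cmeasurable (u n)) ->
  (forall n (x : R), x \in `[0, 1] -> normc (u n x) <= M) ->
  (forall x : R, x \in `[0, 1] -> ccvg (u ^~ x) (f x)) ->
  ccvg (fun n => cintegral D (u n)) (cintegral D f).
Proof.
move=> mu_ uM uf; split => /=.
- apply: (Rintegral_bounded_cvg (u := fun n x => Re (u n x)) (M := M)).
  + by move=> n; case: (mu_ n).
  + by move=> n x x01; apply: le_trans (ler_normc_Re _) (uM n x x01).
  + by move=> x x01; case: (uf x x01).
- apply: (Rintegral_bounded_cvg (u := fun n x => Im (u n x)) (M := M)).
  + by move=> n; case: (mu_ n).
  + by move=> n x x01; apply: le_trans (ler_normc_Im _) (uM n x x01).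
  + by move=> x x01; case: (uf x x01).
Qed.
End bounded_measurable.

(** * Piecewise smooth paths and the fundamental theorem of calculus *)

Section piecewise.
Context {R : realType}.
Implicit Types (h v : R -> R) (S : seq R) (a b c d : R).
Local Notation mu := (@lebesgue_measure R).

(** Quantifying over all intervals whose interior avoids the exceptional points,
    instead of listing the pieces of a subdivision, makes the notion stable under
    enlarging [S]; two paths smooth off different sets are then smooth off the
    concatenation, with no common refinement to build. *)
Definition deriv_off S h v a b :=
  forall c d, a <= c -> c < d -> d <= b ->
    {in S, forall x, ~~ (c < x < d)} ->
    exists dh : R -> R, {within `[c, d], continuous dh} /\
      {in `]c, d[, forall u : R, is_derive u (1 : R) h (dh u) /\ v u = dh u}.

Lemma deriv_off_sub S S' h v a b a' b' : {subset S <= S'} ->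
  a <= a' -> b' <= b -> deriv_off S h v a b -> deriv_off S' h v a' b'.
Proof.
move=> SS' aa' bb' H c d ac cd db Sx; apply: H => //.
- exact: le_trans ac.
- exact: le_trans bb'.
- by move=> x /SS'; exact: Sx.
Qed.

Lemma deriv_off_tail x S h v a b : ~~ (a < x < b) ->
  deriv_off (x :: S) h v a b -> deriv_off S h v a b.
Proof.
move=> xab H c d ac cd db Sx; apply: H => // y; rewrite inE => /predU1P[->|/Sx//].
apply: contra xab => /andP[cx xd].
by rewrite (le_lt_trans ac cx) (lt_le_trans xd db).
Qed.

Lemma continuous_subitv h a b c d : a <= c -> d <= b ->
  {within `[a, b], continuous h} -> {within `[c, d], continuous h}.
Proof.
move=> ac db; apply: continuous_subspaceW.
by apply: subset_itv; rewrite bnd_simp.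
Qed.

Lemma deriv_off_nil_FTC h v a b : a < b -> {within `[a, b], continuous h} ->
  deriv_off [::] h v a b ->
  [/\ measurable_fun `[a, b] v,
      exists M, forall x : R, x \in `[a, b] -> `|v x| <= M &
      (\int[mu]_(x in `[a, b]) v x)%R = h b - h a].
Proof.
move=> ab ch /(_ a b)[]// dh [cdh H].
have vE : {in `]a, b[, forall u, v u = dh u} by move=> u /H[].
have mdh : measurable_fun `[a, b] dh.
  by apply: subspace_continuous_measurable_fun.
have mv : measurable_fun `[a, b] v.
  apply/measurable_fun_itv_bndo_bndcP/measurable_fun_itv_obnd_cbndP.
  apply: (eq_measurable_fun dh); first by move=> x; rewrite inE => /vE.
  by apply: measurable_funS mdh => //; exact: subset_itv_oo_cc.
have [cM _ hM] := EVT_max (ltW ab) (f := fun x => `|dh x|)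
  (fun x => continuous_comp (cdh x) (@norm_continuous _ _ _)).
have bv : forall x : R, x \in `[a, b] -> `|v x| <= Num.max `|dh cM| (Num.max `|v a| `|v b|).
  move=> x xab; rewrite !le_max.
  have [->|xa] := eqVneq x a; first by rewrite lexx orbT.
  have [->|xb] := eqVneq x b; first by rewrite lexx !orbT.
  rewrite vE ?hM//; move: xab; rewrite !in_itv/= !le_eqVlt eq_sym.
  by rewrite (negbTE xa) (negbTE xb).
split => //; first by eexists; exact: bv.
have E : (\int[mu]_(x in `[a, b]) (v x)%:E)%E = (\int[mu]_(x in `[a, b]) (dh x)%:E)%E.
  rewrite -integral_itv_bndo_bndc//; last first.
    apply/(@measurable_EFinP _ (measurableTypeR R)).
    by apply: measurable_funS mv => //; exact: subset_itv_co_cc.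
  rewrite -integral_itv_obnd_cbnd//; last first.
    apply/(@measurable_EFinP _ (measurableTypeR R)).
    by apply: measurable_funS mv => //; exact: subset_itv_oo_cc.
  rewrite -[RHS]integral_itv_bndo_bndc//; last first.
    apply/(@measurable_EFinP _ (measurableTypeR R)).
    by apply: measurable_funS mdh => //; exact: subset_itv_co_cc.
  rewrite -[RHS]integral_itv_obnd_cbnd//; last first.
    apply/(@measurable_EFinP _ (measurableTypeR R)).
    by apply: measurable_funS mdh => //; exact: subset_itv_oo_cc.
  by apply: eq_integral => x; rewrite inE /= => xab; rewrite vE.
have /(continuous_within_itvP _ ab)[_ ha hb] := ch.
rewrite /Rintegral E (continuous_FTC2 ab cdh (F := h))//.
- by split => // x /H[[]].
- by move=> x /H[/@derive_val + _]; rewrite derive1E.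
Qed.

(** By induction on the exceptional points: a point inside the interval splits it
    in two, a point outside it can be discarded. *)
Lemma deriv_off_FTC S h v a b : a <= b -> {within `[a, b], continuous h} ->
  deriv_off S h v a b ->
  [/\ measurable_fun `[a, b] v,
      exists M, forall x : R, x \in `[a, b] -> `|v x| <= M &
      (\int[mu]_(x in `[a, b]) v x)%R = h b - h a].
Proof.
elim: S a b => [|x S ih] a b ab ch H.
  move: ab; rewrite le_eqVlt => /predU1P[<-|ab]; last exact: deriv_off_nil_FTC.
  split; last by rewrite set_itv1 Rintegral_set1 subrr.
    by rewrite set_itv1; exact: measurable_fun_set1.
  by exists `|v a| => x; rewrite in_itv/= -eq_le => /eqP ->.
have [|xab] := boolP (a < x < b); last by apply: ih => //; exact: deriv_off_tail H.
move=> /andP[ax xb].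
have [||m1 [M1 b1] i1] := ih a x (ltW ax).
- by apply: continuous_subitv ch => //; exact: ltW.
- apply: (@deriv_off_tail x); first by rewrite ltxx andbF.
  by apply: deriv_off_sub H => //; exact: ltW.
have [||m2 [M2 b2] i2] := ih x b (ltW xb).
- by apply: continuous_subitv ch => //; exact: ltW.
- apply: (@deriv_off_tail x); first by rewrite ltxx.
  by apply: deriv_off_sub H => //; exact: ltW.
have U : `[a, b]%classic = `[a, x]%classic `|` `]x, b]%classic.
  by rewrite -itv_bndbnd_setU// bnd_simp ltW.
have m2' : measurable_fun `]x, b] v.
  by apply: measurable_funS m2 => //; exact: subset_itv_oc_cc.
have mv : measurable_fun `[a, b] v by rewrite U; apply/measurable_funU => //; split.
have bv : forall y : R, y \in `[a, b] -> `|v y| <= Num.max M1 M2.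
  move=> y; rewrite in_itv/= => /andP[ay yb]; rewrite le_max.
  have [yx|xy] := leP y x; first by rewrite b1// in_itv/= ay.
  by rewrite b2 ?orbT// in_itv/= ltW.
split => //; first by eexists; exact: bv.
have iv (c d : R) : a <= c -> d <= b -> mu.-integrable `[c, d] (EFin \o v).
  move=> ac db.
  apply: measurable_bounded_integrable => //.
  - by rewrite /= lebesgue_measure_itv/=; case: ifP; rewrite -?EFinB ltry.
  - by apply: measurable_funS mv => //; apply: subset_itv; rewrite bnd_simp.
  - exists (Num.max M1 M2); split => [|z Mz y /=]; rewrite ?num_real// in_itv/= => /andP[cy yd].
    apply/ltW/(le_lt_trans (bv _ _)) => //.
    by rewrite in_itv/= (le_trans ac cy) (le_trans yd db).
rewrite U Rintegral_setU//; last 2 first.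
- by rewrite -U; exact: iv.
- apply/disj_set2P/seteqP; split => // y /=; rewrite !in_itv/=.
  by move=> -[/andP[_ yx] /andP[/lt_le_trans/(_ yx)]]; rewrite ltxx.
rewrite Rintegral_itv_obnd_cbnd; last first.
  have := iv x b (ltW ax) (lexx b).
  by apply: integrableS => //; exact: subset_itv_oc_cc.
rewrite i1 i2; lra.
Qed.

Definition pw_primitive S h v :=
  {within `[0, 1], continuous h} /\ deriv_off S h v 0 1.

Lemma pw_primitive_sub S S' h v : {subset S <= S'} ->
  pw_primitive S h v -> pw_primitive S' h v.
Proof. by move=> SS' [ch H]; split => //; apply: deriv_off_sub H. Qed.

Lemma pw_primitive_cst S r : pw_primitive S (cst r) (cst 0).
Proof.
split; first by move=> x; exact: cvg_cst.
move=> c d _ _ _ _; exists (cst 0); split; first by move=> x; exact: cvg_cst.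
by move=> u _; split => //; exact: is_derive_cst.
Qed.

Lemma pw_primitiveD S h1 v1 h2 v2 : pw_primitive S h1 v1 -> pw_primitive S h2 v2 ->
  pw_primitive S (h1 \+ h2) (v1 \+ v2).
Proof.
move=> [c1 H1] [c2 H2]; split.
  by move=> x; apply: cvgD; [exact: c1|exact: c2].
move=> c d c0 cd d1 Sx.
have [d1h [cd1 D1]] := H1 c d c0 cd d1 Sx; have [d2h [cd2 D2]] := H2 c d c0 cd d1 Sx.
exists (d1h \+ d2h); split.
  by move=> x; apply: cvgD; [exact: cd1|exact: cd2].
move=> u ucd; have [? e1] := D1 u ucd; have [? e2] := D2 u ucd.
by split; [exact: is_deriveD|rewrite /= e1 e2].
Qed.

Lemma pw_primitiveM S h1 v1 h2 v2 : pw_primitive S h1 v1 -> pw_primitive S h2 v2 ->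
  pw_primitive S (h1 \* h2) (fun x => h1 x * v2 x + h2 x * v1 x).
Proof.
move=> [c1 H1] [c2 H2]; split.
  by move=> x; apply: cvgM; [exact: c1|exact: c2].
move=> c d c0 cd d1 Sx.
have [d1h [cd1 D1]] := H1 c d c0 cd d1 Sx; have [d2h [cd2 D2]] := H2 c d c0 cd d1 Sx.
have c1' := continuous_subitv c0 d1 c1; have c2' := continuous_subitv c0 d1 c2.
exists (fun x => h1 x * d2h x + h2 x * d1h x); split.
  by move=> x; apply: cvgD; apply: cvgM;
   [exact: c1'|exact: cd2|exact: c2'|exact: cd1].
move=> u ucd; have [? e1] := D1 u ucd; have [? e2] := D2 u ucd.
split; last by rewrite /= e1 e2.
exact: is_deriveM.
Qed.

Lemma pw_primitiveN S h v : pw_primitive S h v -> pw_primitive S (\- h) (\- v).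
Proof.
move=> [c1 H1]; split.
  by move=> x; apply: cvgN; exact: c1.
move=> c d c0 cd d1 Sx.
have [d1h [cd1 D1]] := H1 c d c0 cd d1 Sx.
exists (\- d1h); split.
  by move=> x; apply: cvgN; exact: cd1.
move=> u ucd; have [? e1] := D1 u ucd.
by split; [exact: is_deriveN|rewrite /= e1].
Qed.

(** An interval that avoids the subdivision points lies in one piece, the one
    that ends at the first subdivision point to the right of its left end. *)
Lemma piecewise_C1_primitive h : piecewise_C1 h ->
  exists S, pw_primitive S h (h^`()%classic).
Proof.
move=> [ch [s [_ s1 H]]]; exists s; split => // c d c0 cd d1 Sx.
have cs : has (fun x => c < x) s.
  apply/hasP; exists 1; last exact: lt_le_trans d1.
  case: s s1 {H Sx} => [/= /eqP|y s /= <-]; first by rewrite eq_sym oner_eq0.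
  exact: mem_last.
set k := find (fun x => c < x) s.
have ks : (k < size s)%N by rewrite -has_find.
have [dh [cdh D]] := H _ ks.
have ac : nth 0 (0 :: s) k <= c.
  rewrite /k; case E : (find _ s) => [|j] //=.
  by rewrite leNgt; apply/negbT/(@before_find _ 0 (fun x => c < x)); rewrite E.
have db : d <= nth 0 s k.
  have := Sx _ (mem_nth 0 ks).
  by rewrite (nth_find 0 cs) /= -leNgt.
exists dh; split; first exact: continuous_subitv cdh.
move=> u; rewrite in_itv/= => /andP[cu ud].
have := D u; rewrite in_itv/= (le_lt_trans ac cu) (lt_le_trans ud db) => /(_ isT) Du.
by split => //; rewrite derive1E; exact: derive_val.
Qed.

End piecewise.

Section loops.
Context {R : realType}.
Implicit Types (g G V : R -> R[i]) (S : seq R).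
Local Notation D := (`[0, 1]%classic : set R).

Definition pw_cprimitive S G V :=
  pw_primitive S (fun s => Re (G s)) (fun s => Re (V s)) /\
  pw_primitive S (fun s => Im (G s)) (fun s => Im (V s)).

Lemma pw_cprimitive_cbmeas S G V : pw_cprimitive S G V -> cbmeas V.
Proof.
move=> [[c1 H1] [c2 H2]].
have [m1 [M1 b1] _] := deriv_off_FTC ler01 c1 H1.
have [m2 [M2 b2] _] := deriv_off_FTC ler01 c2 H2.
split; first by split.
exists (M1 + M2) => x x01; apply: (le_trans (ler_normc_ReIm _)).
by rewrite lerD ?b1 ?b2.
Qed.

Lemma pw_cprimitive_integral S G V : pw_cprimitive S G V ->
  cintegral D V = G 1 - G 0.
Proof.
move=> [[c1 H1] [c2 H2]].
have [_ _ i1] := deriv_off_FTC ler01 c1 H1.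
have [_ _ i2] := deriv_off_FTC ler01 c2 H2.
rewrite /cintegral i1 i2; by case: (G 1) (G 0) => a b [].
Qed.

Lemma pw_cprimitiveM S G1 V1 G2 V2 :
  pw_cprimitive S G1 V1 -> pw_cprimitive S G2 V2 ->
  pw_cprimitive S (fun s => G1 s * G2 s) (fun s => G1 s * V2 s + G2 s * V1 s).
Proof.
move=> [r1 i1] [r2 i2]; split.
- have := pw_primitiveD (pw_primitiveM r1 r2) (pw_primitiveN (pw_primitiveM i1 i2)).
  congr (pw_primitive S _ _); apply/funext => s /=; rewrite ?cReD !cReM//; ring.
- have := pw_primitiveD (pw_primitiveM r1 i2) (pw_primitiveM i1 r2).
  congr (pw_primitive S _ _); apply/funext => s /=; rewrite ?cImD !cImM//; ring.
Qed.

Lemma pw_cprimitiveD S G1 V1 G2 V2 :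
  pw_cprimitive S G1 V1 -> pw_cprimitive S G2 V2 ->
  pw_cprimitive S (fun s => G1 s + G2 s) (fun s => V1 s + V2 s).
Proof.
move=> [r1 i1] [r2 i2]; split.
- have := pw_primitiveD r1 r2.
  by congr (pw_primitive S _ _); apply/funext => s /=; rewrite cReD.
- have := pw_primitiveD i1 i2.
  by congr (pw_primitive S _ _); apply/funext => s /=; rewrite cImD.
Qed.

Lemma pw_cprimitive_cst S z : pw_cprimitive S (fun=> z) (fun=> 0).
Proof. by split; exact: pw_primitive_cst. Qed.

Lemma pw_cprimitiveX S G V n : pw_cprimitive S G V ->
  pw_cprimitive S (fun s => G s ^+ n.+1) (fun s => n.+1%:R * (G s ^+ n * V s)).
Proof.
move=> H; elim: n => [|n ih].
  by move: H; congr (pw_cprimitive S _ _); apply/funext => s /=;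
    rewrite ?expr1 ?expr0 ?mul1r.
have := pw_cprimitiveM H ih.
congr (pw_cprimitive S _ _); apply/funext => s; cbv beta.
by rewrite (mulrSr _ n.+1) exprS; ring.
Qed.

Section loop.
Variable g : R -> R[i].
Hypothesis gl : positive_loop_around01 g.

Lemma loop_primitive : exists S, pw_cprimitive S g (cderive g).
Proof.
have [/piecewise_C1_primitive[S1 H1] /piecewise_C1_primitive[S2 H2] _ _ _] := gl.
(* the two coordinates need not be smooth off the same set *)
exists (S1 ++ S2); split.
- by apply: pw_primitive_sub H1 => x; rewrite mem_cat => ->.
- by apply: pw_primitive_sub H2 => x; rewrite mem_cat orbC => ->.
Qed.

Lemma loop_cbmeas : cbmeas g.
Proof.
have [S [[c1 _] [c2 _]]] := loop_primitive.
split; first exact: continuous_cmeasurable.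
have [a1 _ h1] := EVT_max ler01 (f := fun x => `|Re (g x)|)
  (fun x => continuous_comp (c1 x) (@norm_continuous _ _ _)).
have [a2 _ h2] := EVT_max ler01 (f := fun x => `|Im (g x)|)
  (fun x => continuous_comp (c2 x) (@norm_continuous _ _ _)).
eexists => x x01; apply: (le_trans (ler_normc_ReIm _)).
by apply: lerD; [exact: h1|exact: h2].
Qed.

Lemma loop_deriv_cbmeas : cbmeas (cderive g).
Proof. by have [S /pw_cprimitive_cbmeas] := loop_primitive. Qed.

End loop.
End loops.

(** * The complex exponential and the Cauchy formula on a loop *)

(** Two bases that agree to first order in 1/n have the same n-th power in the
    limit; the bound serves the complex exponential as well as the holding times
    of the chain. *)
Lemma ler_norm_subrXX (K : numDomainType) (a b c : K) n :
  `|a| <= c -> `|b| <= c ->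
  `|a ^+ n.+1 - b ^+ n.+1| <= n.+1%:R * c ^+ n * `|a - b|.
Proof.
move=> ac bc; rewrite subrXX normrM mulrC ler_wpM2r//.
apply: (le_trans (ler_norm_sum _ _ _)).
rewrite mulr_natl -[in leRHS](card_ord n.+1) -sumr_const; apply: ler_sum => i _.
rewrite normrM !normrX -[in leRHS](subnK (leq_ord i)) exprD.
have c0 : 0 <= c by apply: le_trans ac.
by apply: ler_pM; rewrite ?exprn_ge0//; rewrite ?subSS; apply: lerXn2r;
  rewrite ?nnegrE.
Qed.

Section exponential.
Context {R : realType}.
Implicit Types (z w : R[i]) (r : R).

Lemma cvg_succ_derive (f : R -> R) (l : R) : is_derive (0 : R) (1 : R) f l ->
  n.+1%:R * (f n.+1%:R^-1 - f 0) @[n --> \oo] --> l.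
Proof.
move=> [df fl].
have : h^-1 *: (f (h *: 1 + 0) - f 0) @[h --> 0^'] --> l by rewrite -fl; exact: df.
move=> /cvgr_dnbhsP/(_ (fun n => n.+1%:R^-1)) H.
have {}H := H (conj (fun n => invr_neq0 (lt0r_neq0 (ltr0Sn _ n))) (@cvg_harmonic R)).
apply: cvg_trans H; apply: near_eq_cvg; apply: nearW => n /=.
by rewrite addr0 invrK /GRing.scale/= mulr1.
Qed.

Lemma is_derive_mull r (x : R) : is_derive x (1 : R) ( *%R r) r.
Proof.
by have := @is_deriveZ _ _ _ id r x 1 1 _; rewrite /GRing.scale/= mulr1; exact.
Qed.

Lemma is_derive_comp_mull (f : R -> R) (r l : R) : is_derive (0 : R) (1 : R) f l ->
  is_derive (0 : R) (1 : R) (f \o *%R r) (l * r).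
Proof.
move=> fl; apply: (@is_derive1_comp R f ( *%R r)); last exact: is_derive_mull.
by rewrite mulr0.
Qed.

Lemma cvg_succ_expR r : n.+1%:R * (expR (r / n.+1%:R) - 1) @[n --> \oo] --> r.
Proof.
have := cvg_succ_derive (is_derive_comp_mull r (is_derive_expR 0)).
by rewrite /= mulr0 expR0 mul1r.
Qed.

Lemma cexpD z w : cexp (z + w) = cexp z * cexp w.
Proof.
case: z w => a b [c d]; rewrite /cexp /= expRD cosD sinD.
apply/eqP; rewrite eq_complex /=; apply/andP; split; apply/eqP; ring.
Qed.

Lemma cexp0 : cexp (0 : R[i]) = 1.
Proof. by rewrite /cexp /= expR0 cos0 sin0 mul1r. Qed.

Lemma cexpR r : cexp r%:C = (expR r)%:C.
Proof. by rewrite /cexp /= cos0 sin0 mulr1. Qed.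

Lemma cexp_mulrn z n : cexp (z *+ n) = cexp z ^+ n.
Proof. by elim: n => [|n ih]; rewrite ?mulr0n ?cexp0// mulrS cexpD ih exprS. Qed.

Lemma normc_cexp z : normc (cexp z) = expR (Re z).
Proof.
rewrite /cexp normcM normcR ger0_norm ?expR_ge0//.
by rewrite normc_sqrtE /= cos2Dsin2 sqrtr1 mulr1.
Qed.

Lemma cexp_le z : normc (cexp z) <= expR (normc z).
Proof.
by rewrite normc_cexp ler_expR (le_trans (ler_norm _))// ler_normc_Re.
Qed.

Lemma cexp_div_succ z n : cexp (z / n.+1%:R) ^+ n.+1 = cexp z.
Proof. by rewrite -cexp_mulrn -[_ / _ *+ _]mulr_natr divfK// pnatr_eq0. Qed.

Lemma divc_nat z n : z / n.+1%:R = (Re z / n.+1%:R) +i* (Im z / n.+1%:R).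
Proof.
rewrite -[n.+1%:R in LHS](rmorph_nat (real_complex R)) -fmorphV /=.
by case: z => a b; apply/eqP; rewrite eq_complex /= !mulr0 subr0 add0r !eqxx.
Qed.

Lemma mulc_nat z n : n%:R * z = (n%:R * Re z) +i* (n%:R * Im z).
Proof.
rewrite -[n%:R in LHS](rmorph_nat (real_complex R)) /=.
by case: z => a b; apply/eqP; rewrite eq_complex /= !mul0r subr0 addr0 !eqxx.
Qed.

Lemma ccvg_succ_cexp z : ccvg (fun n => n.+1%:R * (cexp (z / n.+1%:R) - 1)) z.
Proof.
have E (f g : R -> R) x : (f * g) x = f x * g x by [].
have D1 := is_derive_comp_mull (Re z) (is_derive_expR 0).
have D2 := is_derive_comp_mull (Im z) (is_derive_cos 0).
have D3 := is_derive_comp_mull (Im z) (is_derive_sin 0).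
split.
- have := cvg_succ_derive (is_deriveM D1 D2).
  rewrite /GRing.scale /= !mulr0 !expR0 !cos0 !sin0 oppr0 !mul0r !mul1r add0r.
  apply: cvg_trans; apply: near_eq_cvg; apply: nearW => n.
  rewrite divc_nat mulc_nat /cexp !E /= !mulr0 expR0 ?cos0 ?sin0. ring.
- have := cvg_succ_derive (is_deriveM D1 D3).
  rewrite /GRing.scale /= !mulr0 !expR0 !cos0 !sin0 !mul0r !mul1r addr0.
  apply: cvg_trans; apply: near_eq_cvg; apply: nearW => n.
  rewrite divc_nat mulc_nat /cexp !E /= !mulr0 expR0 ?cos0 ?sin0. ring.
Qed.

Lemma normc_div_nat z n : normc (z / n.+1%:R) = normc z / n.+1%:R.
Proof.
rewrite normcM normcV; congr (_ / _).
by rewrite -(rmorph_nat (real_complex R)) normcR ger0_norm.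
Qed.

Lemma normc_1D z : normc (1 + z) <= expR (normc z).
Proof.
apply: le_trans (ler_normcD _ _) _.
by rewrite Normc.normc1 expR_ge1Dx.
Qed.

Lemma expR_div_succ r n : expR (r / n.+1%:R) ^+ n.+1 = expR r.
Proof. by rewrite -expRM_natr divfK// pnatr_eq0. Qed.

Lemma normc_1Ddiv z n : normc ((1 + z / n.+1%:R) ^+ n.+1) <= expR (normc z).
Proof.
rewrite normcX -(expR_div_succ (normc z) n).
by apply: lerXn2r; rewrite ?nnegrE ?normc_ge0 ?expR_ge0// -normc_div_nat normc_1D.
Qed.

(** The limit of the powers (1 + z/n)^n rather than the exponential series: only
    the derivative at 0 and the additivity of [cexp] are used, and the partial
    approximations are polynomials, whose integrals along a loop are elementary. *)
Lemma cexp_lim z : ccvg (fun n => (1 + z / n.+1%:R) ^+ n.+1) (cexp z).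
Proof.
apply: ccvg_normc0.
pose e := expR (normc z).
have H n : normc ((1 + z / n.+1%:R) ^+ n.+1 - cexp z) <=
   e * normc (n.+1%:R * (cexp (z / n.+1%:R) - 1) - z).
  rewrite -(cexp_div_succ z n).
  set b := cexp _; set a := 1 + _; pose c := expR (normc z / n.+1%:R).
  have ac : normc a <= c by rewrite /c -normc_div_nat normc_1D.
  have bc : normc b <= c by rewrite /c -normc_div_nat cexp_le.
  have c1 : 1 <= c by rewrite /c -expR0 ler_expR divr_ge0 ?normc_ge0.
  have cn : c ^+ n <= e.
    by rewrite /e -(expR_div_succ _ n) -/c exprS ler_peMl// exprn_ge0// (le_trans ler01).
  have : normc (a ^+ n.+1 - b ^+ n.+1) <= n.+1%:R * c ^+ n * normc (a - b).
    have := @ler_norm_subrXX R[i] a b c%:C n.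
    rewrite !normCE !lecR => /(_ ac bc).
    by rewrite -(rmorph_nat (real_complex R)) -rmorphXn -!rmorphM lecR.
  move=> /le_trans; apply.
  have -> : normc (n.+1%:R * (b - 1) - z) = n.+1%:R * normc (a - b).
    rewrite -normcN -[n.+1%:R in RHS](_ : normc n.+1%:R = _); last first.
      by rewrite -(rmorph_nat (real_complex R)) normcR ger0_norm.
    rewrite -normcM /a; congr normc.
    have n0 : n.+1%:R != 0 :> R[i] by rewrite pnatr_eq0.
    by field.
  rewrite (mulrC n.+1%:R) -mulrA ler_wpM2r// mulr_ge0 ?normc_ge0//.
apply: (@squeeze_cvgr _ _ _ _ (cst 0)
  (fun n => e * normc (n.+1%:R * (cexp (z / n.+1%:R) - 1) - z))).
- by apply: nearW => n; rewrite normc_ge0 H.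
- exact: cvg_cst.
- rewrite -(mulr0 e); apply: cvgM; first exact: cvg_cst.
  have := ccvg_normc (ccvgD (ccvg_succ_cexp z) (ccvg_cst (- z))).
  by rewrite subrr Normc.normc0.
Qed.

End exponential.

Section cauchy.
Context {R : realType}.
Implicit Types (z w : R[i]).
Local Notation D := (`[0, 1]%classic : set R).

(** The modulus of Im z plus twice the distance from Re z to [0, 1]: it is
    comparable to the distance from z to [0, 1] and obviously continuous in z. *)
Definition gap01 z : R := `|Im z| + (`|Re z| + `|Re z - 1| - 1).

Lemma gap01_ge0 z : 0 <= gap01 z.
Proof.
rewrite /gap01 addr_ge0// subr_ge0.
by have := ler_normB (Re z) (Re z - 1); rewrite subKr normr1.
Qed.

Lemma gap01_eq0 z : gap01 z = 0 -> exists2 x : R, x \in `[0, 1] & z = x%:C.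
Proof.
move=> /eqP; rewrite paddr_eq0//; last first.
  by rewrite subr_ge0; have := ler_normB (Re z) (Re z - 1); rewrite subKr normr1.
case: z => x y /= /andP[/eqP/normr0_eq0 -> /eqP h]; exists x => //.
rewrite in_itv /=; move: h.
by case: (ger0P x) => x0; case: (ger0P (x - 1)) => x1 h; apply/andP; split; lra.
Qed.

Lemma gap01_le_dist z (x : R) : x \in `[0, 1] -> gap01 z <= 3 * normc (z - x%:C).
Proof.
rewrite in_itv/= => /andP[x0 x1].
have h1 := ler_normc_Re (z - x%:C); have h2 := ler_normc_Im (z - x%:C).
move: h1 h2; rewrite cReB cImB /= subr0 /gap01 => h1 h2.
have h3 : `|Re z| + `|Re z - 1| - 1 <= 2 * `|Re z - x|; last lra.
by case: (ger0P (Re z)); case: (ger0P (Re z - 1)); case: (ger0P (Re z - x)); lra.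
Qed.

Variable g : R -> R[i].
Hypothesis gl : positive_loop_around01 g.

(** A continuous positive function on a compact interval is bounded below. *)
Lemma loop_gap : exists2 r : R, 0 < r & forall s : R, s \in `[0, 1] -> r <= gap01 (g s).
Proof.
have [S [[c1 _] [c2 _]]] := loop_primitive gl.
have c : {within `[0, 1], continuous (fun s => gap01 (g s))}.
  move=> s; apply: cvgD; first by apply: cvg_norm; exact: c2.
  apply: cvgB; last exact: cvg_cst.
  apply: cvgD; first by apply: cvg_norm; exact: c1.
  by apply: cvg_norm; apply: cvgB; [exact: c1|exact: cvg_cst].
have [a a01 ha] := EVT_min ler01 c.
exists (gap01 (g a)) => //; rewrite lt_neqAle gap01_ge0 andbT eq_sym.
apply/eqP => /gap01_eq0[x x01 gx].
have [_ _ _ /(_ a x a01 x01)] := gl.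
by rewrite gx eqxx.
Qed.

Lemma loop_subV_cbmeas (x : R) : x \in `[0, 1] -> cbmeas (fun s => (g s - x%:C)^-1).
Proof.
move=> x01; have [r r0 gr] := loop_gap.
apply: (@cbmeasV _ _ (r / 3)); first by rewrite divr_gt0.
  by case: (cbmeasD (loop_cbmeas gl) (cbmeas_cst (- x%:C))).
move=> s s01; rewrite ler_pdivrMr// mulrC.
exact: le_trans (gr s s01) (gap01_le_dist _ x01).
Qed.

Lemma loop_subV x : x \in `[0, 1] ->
  cintegral D (fun s => (g s - x%:C)^-1 * cderive g s) = two_pi_i R.
Proof.
move=> x01; have [_ _ _ _ /(_ x x01)] := gl.
rewrite /winding_number => /(canRL (mulVKf _)); rewrite mulr1; apply.
rewrite eq_complex /= eqxx /= mulf_eq0 pnatr_eq0 /=.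
exact/lt0r_neq0/pi_gt0.
Qed.

(** The integrand is the derivative of a power of an affine function of the loop.
    The factor [u] is kept so that the case u = 0 needs no separate primitive. *)
Lemma loop_affineX (u : R[i]) n :
  u * cintegral D (fun s => (1 + u * g s) ^+ n * cderive g s) = 0.
Proof.
have [S H] := loop_primitive gl.
have b : cbmeas (fun s => 1 + u * g s).
  apply: cbmeasD; first exact: cbmeas_cst.
  by apply: cbmeasM; [exact: cbmeas_cst|exact: loop_cbmeas].
have H1 : pw_cprimitive S (fun s => 1 + u * g s) (fun s => u * cderive g s).
  have [[c1 d1] [c2 d2]] := H.
  have := pw_cprimitiveM (pw_cprimitive_cst S u) H.
  move=> H2; have := pw_cprimitiveD (pw_cprimitive_cst S 1) H2.
  by congr (pw_cprimitive S _ _); apply/funext => s; ring.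
have := pw_cprimitive_integral (pw_cprimitiveX n H1).
have -> : g 0 = g 1 by case: gl.
rewrite subrr cintegralZ; last first.
  apply: cbmeasM; [exact: cbmeasX|apply: cbmeasM; [exact: cbmeas_cst|exact: loop_deriv_cbmeas]].
move=> /eqP; rewrite mulf_eq0 pnatr_eq0 /= => /eqP <-.
rewrite -cintegralZ; last by apply: cbmeasM; [exact: cbmeasX|exact: loop_deriv_cbmeas].
by apply: eq_cintegral => s _; ring.
Qed.

(** Since 1 + u z = (1 + u x) + u (z - x), one factor trades 1/(z - x) for a
    polynomial, which integrates to 0; the case n = 0 is the winding number. *)
Lemma loop_affineX_subV (u : R[i]) n x : x \in `[0, 1] ->
  cintegral D (fun s => (1 + u * g s) ^+ n * ((g s - x%:C)^-1 * cderive g s)) =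
  (1 + u * x%:C) ^+ n * two_pi_i R.
Proof.
move=> x01.
have b : cbmeas (fun s => 1 + u * g s).
  apply: cbmeasD; first exact: cbmeas_cst.
  by apply: cbmeasM; [exact: cbmeas_cst|exact: loop_cbmeas].
have bd := loop_deriv_cbmeas gl; have bx := loop_subV_cbmeas x01.
elim: n => [|n ih].
  rewrite expr0 mul1r -(loop_subV x01).
  by apply: eq_cintegral => s _; rewrite expr0 mul1r.
rewrite exprS -mulrA -ih.
rewrite -[RHS]addr0 -(loop_affineX u n) -!cintegralZ; last 2 first.
- by apply: cbmeasM => //; exact: cbmeasX.
- by apply: cbmeasM; [exact: cbmeasX|exact: cbmeasM].
rewrite -cintegralD; last 2 first.
- by apply: cbmeasM; [exact: cbmeas_cst|apply: cbmeasM; [exact: cbmeasX|exact: cbmeasM]].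
- by apply: cbmeasM; [exact: cbmeas_cst|apply: cbmeasM; [exact: cbmeasX|]].
apply: eq_cintegral => s s01.
have gx : g s - x%:C != 0.
  rewrite subr_eq0; have [_ _ _ h _] := gl; exact: h.
by rewrite exprS; field.
Qed.

(** The Cauchy formula for the exponential, valid for every loop of winding
    number 1 around x. It is exact on the polynomials (1 - r z/n)^n, which converge
    boundedly on the loop. *)
Lemma loop_cexp_subV (r x : R) : x \in `[0, 1] ->
  cintegral D (fun s => cexp (- (r%:C * g s)) * ((g s - x%:C)^-1 * cderive g s)) =
  (expR (- (r * x)))%:C * two_pi_i R.
Proof.
move=> x01.
have bx : cbmeas (fun s => (g s - x%:C)^-1 * cderive g s).
  by apply: cbmeasM; [exact: loop_subV_cbmeas|exact: loop_deriv_cbmeas].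
pose u n : R[i] := (- r%:C) / n.+1%:R.
have E n z : u n * z = - (r%:C * z) / n.+1%:R by rewrite /u; ring.
have [mg [M gM]] := loop_cbmeas gl.
have [mx [K xK]] := bx.
have b n : cbmeas (fun s => 1 + u n * g s).
  apply: cbmeasD; first exact: cbmeas_cst.
  by apply: cbmeasM; [exact: cbmeas_cst|exact: loop_cbmeas].
have L1 : ccvg (fun n => cintegral D (fun s => (1 + u n * g s) ^+ n.+1 *
    ((g s - x%:C)^-1 * cderive g s)))
    (cintegral D (fun s => cexp (- (r%:C * g s)) * ((g s - x%:C)^-1 * cderive g s))).
  apply: (@cintegral_bounded_cvg _ _ _ (expR (`|r| * M) * K)).
  - by move=> n; apply: (cbmeasM (cbmeasX n.+1 (b n)) bx).1.
  - move=> n s s01; rewrite normcM; apply: ler_pM; rewrite ?normc_ge0//; last exact: xK.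
    rewrite E; apply: le_trans (normc_1Ddiv _ _) _.
    by rewrite ler_expR normcN normcM normcR ler_wpM2l// gM.
  - move=> s s01; apply: ccvgM; last exact: ccvg_cst.
    by under eq_fun do rewrite E; exact: cexp_lim.
apply: ccvg_unique L1 _.
have -> : (fun n => cintegral D (fun s => (1 + u n * g s) ^+ n.+1 *
    ((g s - x%:C)^-1 * cderive g s))) = (fun n => (1 + u n * x%:C) ^+ n.+1 * two_pi_i R).
  by apply/funext => n; rewrite loop_affineX_subV.
apply: ccvgM; last exact: ccvg_cst.
under eq_fun do rewrite E.
have -> : (expR (- (r * x)))%:C = cexp (- (r%:C * x%:C)).
  by rewrite -cexpR rmorphN rmorphM.
exact: cexp_lim.
Qed.

End cauchy.

(** * Diagonalization of the generator *)

Section spectral_decomposition.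
Local Open Scope sesquilinear_scope.
Variable C : numClosedFieldType.

Lemma mulmx_tC_diag_ge0 m n (M : 'M[C]_(m, n)) i : 0 <= (M *m M^t*) i i.
Proof.
by rewrite mxE sumr_ge0// => k _; rewrite !mxE -normCK exprn_ge0.
Qed.

Variables (n : nat) (x : 'I_n.+1 -> C).
Hypothesis x01 : forall i, 0 < x i <= 1.

Let s i := sqrtC (x i).
Let avg : 'M[C]_n.+1 := const_mx n.+1%:R^-1.
Let diagf (f : 'I_n.+1 -> C) : 'M[C]_n.+1 := diag_mx (\row_i f i).

Lemma diagf_tC f : (forall i, 0 <= f i) -> (diagf f)^t* = diagf f.
Proof.
move=> f0; apply/matrixP => i j; rewrite !mxE.
rewrite rmorphMn /= conj_Creal ?ger0_real// eq_sym.
by case: eqVneq => // ->.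
Qed.

Lemma diagf_mul f g : diagf f *m diagf g = diagf (fun i => f i * g i).
Proof.
rewrite /diagf mulmx_diag; congr diag_mx.
by apply/rowP => i; rewrite !mxE.
Qed.

Lemma avg_tC : avg^t* = avg.
Proof.
apply/matrixP => i j; rewrite !mxE conj_Creal// ger0_real// invr_ge0.
Qed.

Lemma avg_idem : avg *m avg = avg.
Proof.
apply/matrixP => i j; rewrite !mxE.
under eq_bigr do rewrite !mxE.
by rewrite sumr_const card_ord -[(_ * _) *+ _]mulr_natl mulVKf// pnatr_eq0.
Qed.

Let ctr := 1%:M - avg.

Lemma ctr_tC : ctr^t* = ctr.
Proof. by rewrite /ctr linearB /= map_mxB trmx1 map_mx1 avg_tC. Qed.

Lemma ctr_idem : ctr *m ctr = ctr.
Proof. by rewrite /ctr mulmxBl mul1mx mulmxBr mulmx1 avg_idem subrr subr0. Qed.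

(** With D the diagonal matrix of the [x i], the matrix D (1 - avg) is similar to
    the Hermitian matrix S = D^(1/2) (1 - avg) D^(1/2). As avg and 1 - avg are
    orthogonal projections, S and 1 - S = (1 - D) + D^(1/2) avg D^(1/2) are sums of
    matrices M M*, so that the eigenvalues of S lie in [0, 1]. *)
Lemma generator_spectral : exists (V : 'M[C]_n.+1) (l : 'I_n.+1 -> C),
  [/\ V \in unitmx, forall j, 0 <= l j <= 1 &
   diagf x *m ctr = invmx V *m diagf l *m V].
Proof.
have s0 i : 0 <= s i by rewrite sqrtC_ge0 ltW//; case/andP: (x01 i).
pose Ds := diagf s; pose S := Ds *m ctr *m Ds.
have DsDs : Ds *m Ds = diagf x.
  by rewrite diagf_mul; congr diagf; apply/funext => i; rewrite -expr2 sqrtCK.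
have DsC : Ds^t* = Ds by exact: diagf_tC.
have SE : S = (Ds *m ctr) *m (Ds *m ctr)^t*.
  by rewrite trmx_mul map_mxM ctr_tC DsC !mulmxA -[_ *m ctr *m ctr]mulmxA ctr_idem.
have Sh : S \is hermsymmx.
  apply/is_hermitianmxP; rewrite expr0 scale1r SE.
  by move: (Ds *m ctr) => M; rewrite trmx_mul map_mxM trmxCK.
have /orthomx_spectralP := hermitian_normalmx Sh.
set P := spectralmx S; set d := spectral_diag S => PS.
have Pun : P \is unitarymx by exact: spectral_unitarymx.
have Pu : P \in unitmx by exact: spectral_unit.
have PPt : P *m P^t* = 1%:M by exact/unitarymxP.
have dE : diag_mx d = P *m S *m P^t*.
  by rewrite {1}PS !mulmxA mulmxV// mul1mx -mulmxA PPt mulmx1.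
have dd j : d 0 j = (diag_mx d) j j by rewrite mxE eqxx mulr1n.
have d0 j : 0 <= d 0 j.
  rewrite dd dE SE (_ : P *m _ *m P^t* = (P *m Ds *m ctr) *m (P *m Ds *m ctr)^t*).
    exact: mulmx_tC_diag_ge0.
  by rewrite !trmx_mul !map_mxM !mulmxA.
pose Dr := diagf (fun i => sqrtC (1 - x i)).
have r0 i : 0 <= sqrtC (1 - x i) by rewrite sqrtC_ge0 subr_ge0; case/andP: (x01 i).
have DrC : Dr^t* = Dr by exact: diagf_tC.
(* 1 - S is the sum of the nonnegative matrices 1 - D and D^(1/2) avg D^(1/2) *)
have SE1 : 1%:M - S = Dr *m Dr + (Ds *m avg) *m (Ds *m avg)^t*.
  rewrite trmx_mul map_mxM avg_tC DsC !mulmxA -[_ *m avg *m avg]mulmxA avg_idem.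
  rewrite /S /ctr mulmxBr mulmx1 mulmxBl DsDs opprB addrCA addrC; congr (_ + _).
  rewrite diagf_mul; apply/matrixP => i j; rewrite !mxE.
  by case: eqVneq => [->|]; rewrite ?subr0// !mulr1n -expr2 sqrtCK.
have d1 j : d 0 j <= 1.
  rewrite -subr_ge0 dd (_ : 1 - _ = (P *m (1%:M - S) *m P^t*) j j); last first.
    rewrite mulmxBr mulmx1 mulmxBl PPt -dE !mxE eqxx //.
  rewrite SE1 mulmxDr mulmxDl mxE.
  rewrite (_ : P *m (Dr *m Dr) *m P^t* = (P *m Dr) *m (P *m Dr)^t*); last first.
    by rewrite trmx_mul map_mxM DrC !mulmxA.
  rewrite (_ : P *m (_ *m _) *m P^t* = (P *m Ds *m avg) *m (P *m Ds *m avg)^t*); last first.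
    by rewrite !trmx_mul !map_mxM !mulmxA.
  by rewrite addr_ge0// mulmx_tC_diag_ge0.
have Dsu : Ds \in unitmx.
  rewrite unitmxE det_diag unitfE prodf_seq_neq0; apply/allP => i _ /=.
  by rewrite mxE sqrtC_eq0 gt_eqF//; case/andP: (x01 i).
have Vu : P *m invmx Ds \in unitmx by rewrite unitmx_mul Pu unitmx_inv.
exists (P *m invmx Ds), (fun j => d 0 j); split => //.
  by move=> j; rewrite d0 d1.
have -> : diagf (fun j => d 0 j) = diag_mx d.
  by congr diag_mx; apply/rowP => j; rewrite mxE.
have PSd : diag_mx d *m P = P *m S by rewrite dE mulmxKtV.
apply: (can_inj (mulKmx Vu)); rewrite !mulmxA mulmxV// mul1mx PSd.
by rewrite -DsDs !mulmxA mulmxKV// mulmxK.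
Qed.

Lemma trap_matrix_spectral : exists (V : 'M[C]_n.+1) (l : 'I_n.+1 -> C),
  [/\ V \in unitmx, forall j, 0 <= l j <= 1 &
   \matrix_(i, j) (x i / n.+1%:R - x i *+ (i == j)) =
   invmx V *m diag_mx (\row_j - l j) *m V].
Proof.
have [V [l [Vu l01 E]]] := generator_spectral; exists V, l; split => //.
have -> : \matrix_(i, j) (x i / n.+1%:R - x i *+ (i == j)) = - (diagf x *m ctr).
  apply/matrixP => i j; rewrite mul_diag_mx !mxE.
  by rewrite mulrBr opprB mulr_natr.
rewrite E -mulNmx -mulmxN; congr (_ *m _ *m _).
by apply/matrixP => i j; rewrite !mxE mulNrn.
Qed.

End spectral_decomposition.

Lemma diagonalized_entryX (C : fieldType) n (A V : 'M[C]_n.+1) (d : 'I_n.+1 -> C) :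
  V \in unitmx -> A = invmx V *m diag_mx (\row_j d j) *m V ->
  forall k a b, (A ^+ k) a b = \sum_j invmx V a j * V j b * d j ^+ k.
Proof.
move=> Vu E k.
have Ek : A ^+ k = invmx V *m diag_mx (\row_j d j ^+ k) *m V.
  elim: k => [|k ih].
    rewrite expr0 (_ : diag_mx _ = 1%:M) ?mulmx1 ?mulVmx//.
    by apply/matrixP => i j; rewrite !mxE expr0.
  rewrite exprSr -[_ * _]/(_ *m _) ih E.
  rewrite !mulmxA mulmxK// -[_ *m diag_mx _ *m diag_mx _]mulmxA.
  rewrite mulmx_diag; congr (_ *m diag_mx _ *m _).
  by apply/rowP => j; rewrite !mxE exprSr.
move=> a b; rewrite Ek mxE; apply: eq_bigr => j _.
rewrite mxE (bigD1 j)//= big1 ?addr0; last first.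
  by move=> i /negbTE ij; rewrite !mxE ij mulr0n mulr0.
by rewrite !mxE eqxx mulr1n mulrAC.
Qed.

Lemma diagonalized_resolvent (C : fieldType) n (A V : 'M[C]_n.+1)
    (d v : 'I_n.+1 -> C) z :
  V \in unitmx -> A = invmx V *m diag_mx (\row_j d j) *m V ->
  (forall j, z - d j != 0) ->
  let u i := \sum_j invmx V i j * (\sum_b V j b * v b) / (z - d j) in
  forall i, z * u i - \sum_j A i j * u j = v i.
Proof.
move=> Vu E zd u i.
pose vv : 'cV[C]_n.+1 := \col_i v i.
pose y : 'cV[C]_n.+1 := \col_j ((V *m vv) j 0 / (z - d j)).
have uE : \col_i u i = invmx V *m y.
  apply/colP => k; rewrite !mxE; apply: eq_bigr => j _; rewrite !mxE mulrA.
  by congr (_ * _ / _); apply: eq_bigr => b _; rewrite !mxE.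
suff : z *: (\col_i u i) - A *m \col_i u i = vv.
  move=> /matrixP/(_ i 0); rewrite !mxE => <-; congr (_ - _).
  by apply: eq_bigr => j _; rewrite !mxE.
rewrite uE E -!mulmxA mulKVmx// scalemxAr -mulmxBr.
apply: (can_inj (mulKmx Vu)); rewrite mulKVmx//.
apply/colP => j; rewrite mul_diag_mx !mxE -mulrBl mulrC divfK//.
Qed.

(** * Semigroup and resolvent of the trap chain *)

Section trap_generator.
Context {R : realType}.
Variables (x : nat -> R) (N : nat).
Hypothesis x01 : forall i, 0 < x i <= 1.
Local Notation toC := (real_complex R).
Local Notation Q := (rate_generator (@trap_rate R x N)).
Local Notation n := (N.+1).

(** The diagonal entry counts N jumps of rate x i / (N + 1), hence the rank one
    correction of the diagonal matrix of the [- x i]. *)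
Lemma trap_generatorE i j :
  Q i j = x i / n%:R - x i *+ (i == j).
Proof.
rewrite mxE; case: eqVneq => [->|_]; last by rewrite mulr0n subr0.
rewrite /trap_rate sumr_const cardC1 card_ord /= mulr1n.
set y := x j / n%:R; have -> : x j = y * n%:R by rewrite /y divfK// pnatr_eq0.
by rewrite -mulr_natr (mulrS 1 N); ring.
Qed.

(** The eigenvalues are real, so that they can be compared with the points of
    [0, 1] around which a loop winds. *)
Lemma trap_generator_spectral :
  exists (V : 'M[R[i]]_n) (l : 'I_n -> R),
  [/\ V \in unitmx, forall j, 0 <= l j <= 1 &
   map_mx toC Q = invmx V *m diag_mx (\row_j - (l j)%:C) *m V].
Proof.
have [|V [l [Vu l01 E]]] := @trap_matrix_spectral R[i] N (fun i => (x i)%:C).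
  by move=> i; have := x01 i; rewrite !ltcR !lecR.
have lR j : (Re (l j))%:C = l j.
  by apply: RRe_real; apply: ger0_real; case/andP: (l01 j).
exists V, (fun j => Re (l j)); split; first exact: Vu.
  by move=> j; have := l01 j; rewrite -lR !lecR.
have -> : \row_j - (Re (l j))%:C = \row_j - l j.
  by apply/rowP => j; rewrite !mxE lR.
rewrite -E; apply/matrixP => i j; rewrite mxE trap_generatorE mxE.
by rewrite rmorphB rmorphM fmorphV rmorph_nat rmorphMn.
Qed.

(** The topology on matrices is the product topology of the entries. *)
Lemma cvg_mx_entries (u : nat -> 'M[R]_n) (A : 'M[R]_n) :
  (forall i j, u k i j @[k --> \oo] --> A i j) -> u @ \oo --> A.
Proof.
move=> uA B [P AP PB].
suff : \forall k \near \oo, forall i j, P i j (u k i j).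
  by apply: filterS => k; exact: PB.
apply: filter_forall => i; apply: filter_forall => j.
exact: uA (AP i j).
Qed.

Lemma cvg_entries (u : nat -> 'M[R]_n) (A : 'M[R]_n) :
  u @ \oo --> A -> forall i j, u k i j @[k --> \oo] --> A i j.
Proof.
move=> uA i j B AB.
apply: (uA [set M | B (M i j)]).
exists (fun i' j' => [set r | (i' == i) && (j' == j) -> B r]).
  move=> i' j'; have [/andP[/eqP -> /eqP ->]|_] := boolP ((i' == i) && (j' == j)).
    by apply: filterS AB => r Br _.
  by apply: filterS filterT => r _.
by move=> M /(_ i j) /=; rewrite !eqxx; apply.
Qed.

Section decomposition.
Variables (V : 'M[R[i]]_n) (l : 'I_n -> R).
Hypothesis Vu : V \in unitmx.
Hypothesis QV : map_mx toC Q = invmx V *m diag_mx (\row_j - (l j)%:C) *m V.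
Let c a b j := invmx V a j * V j b.

Lemma trap_generatorX k a b :
  ((Q ^+ k) a b)%:C = \sum_j c a b j * ((- l j) ^+ k)%:C.
Proof.
have := diagonalized_entryX Vu QV k a b.
rewrite -(rmorphXn (map_mx toC)) mxE => ->.
by apply: eq_bigr => j _; rewrite rmorphXn rmorphN.
Qed.

(** The partial sums of the exponential series are computed on the eigenvalues. *)
Lemma expmx_entry t a b :
  ((expmx (t *: Q)) a b)%:C = \sum_j c a b j * (expR (- (t * l j)))%:C.
Proof.
pose E := \matrix_(a, b) Re (\sum_j c a b j * (expR (- (t * l j)))%:C).
have S K a' b' : ((series (fun k => k`!%:R^-1 *: (t *: Q) ^+ k) K) a' b')%:C =
    \sum_j c a' b' j * (series (exp_coeff (- (t * l j))) K)%:C.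
  rewrite /series /= summxE rmorph_sum /=.
  under eq_bigr => k _ do rewrite exprZn !mxE !rmorphM /= trap_generatorX.
  under [RHS]eq_bigr => j _ do rewrite rmorph_sum mulr_sumr.
  rewrite [RHS]exchange_big /=; apply: eq_bigr => k _.
  rewrite !mulr_sumr; apply: eq_bigr => j _.
  rewrite /exp_coeff /= -mulrN exprMn !rmorphM /c; ring.
have cv a' b' : ccvg (fun K => ((series (fun k => k`!%:R^-1 *: (t *: Q) ^+ k) K) a' b')%:C)
    (\sum_j c a' b' j * (expR (- (t * l j)))%:C).
  under eq_fun do rewrite S.
  apply: ccvg_sum => j; apply: ccvgM; first exact: ccvg_cst.
  by apply: ccvgR; exact: is_cvg_series_exp_coeff.
have EE : series (fun k => k`!%:R^-1 *: (t *: Q) ^+ k) @ \oo --> E.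
  by apply: cvg_mx_entries => i j; rewrite mxE; case: (cv i j).
have h1 := @cvg_entries _ _ (cvgP _ EE) a b.
have [h2 h3] := cv a b.
apply/eqP; rewrite eq_complex; apply/andP; split; apply/eqP.
- exact: cvg_unique h1 h2.
- exact: cvg_unique (cvg_cst 0) h3.
Qed.

Lemma sum_coeff a b : \sum_j c a b j = (a == b)%:R.
Proof.
have := trap_generatorX 0 a b; rewrite expr0 mxE => e.
transitivity (((a == b)%:R : R)%:C); last by case: eqP.
by rewrite e; apply: eq_bigr => j _; rewrite expr0 mulr1.
Qed.

Lemma expmx_diag_derivative t i :
  m.+1%:R * (expmx ((t / m.+1%:R) *: Q) i i - 1) @[m --> \oo] --> t * Q i i.
Proof.
suff [+ _] : ccvg (fun m => (m.+1%:R * (expmx ((t / m.+1%:R) *: Q) i i - 1))%:C)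
   (t * Q i i)%:C by [].
have -> : (t * Q i i)%:C = \sum_j c i i j * (- (t * l j))%:C.
  have := trap_generatorX 1 i i; rewrite expr1 => e.
  rewrite rmorphM /= e mulr_sumr.
  by apply: eq_bigr => j _; rewrite expr1 -mulrN rmorphM /c; ring.
have -> : (fun m => (m.+1%:R * (expmx ((t / m.+1%:R) *: Q) i i - 1))%:C) =
   (fun m => \sum_j c i i j * (m.+1%:R * (expR (- (t * l j) / m.+1%:R) - 1))%:C).
  apply/funext => m; rewrite rmorphM rmorphB /= expmx_entry.
  have -> : 1%:C = \sum_j c i i j by rewrite sum_coeff eqxx.
  rewrite -sumrB mulr_sumr; apply: eq_bigr => j _.
  rewrite rmorphM rmorphB /=.
  rewrite (_ : - (t / m.+1%:R * l j) = - (t * l j) / m.+1%:R); last by ring.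
  by rewrite rmorph1; ring.
apply: ccvg_sum => j; apply: ccvgM; first exact: ccvg_cst.
by apply: ccvgR; exact: cvg_succ_expR.
Qed.

End decomposition.

(** The equation (z + Q) u = v reads z u_i + x_i (ubar - u_i) = v_i: the unknown
    [u i] depends on the others through the mean [ubar] only. Solving for [u i] and
    averaging determines [ubar], which is the ratio appearing in the contour
    formula. *)
Lemma trap_resolvent (v u : 'I_n -> R[i]) z (ubar := n%:R^-1 * \sum_i u i) :
  (forall i : 'I_n, z != (x i)%:C) ->
  (forall i, z * u i + \sum_j (Q i j)%:C * u j = v i) ->
  ubar * (z * (n%:R^-1 * \sum_(i < n) (z - (x i)%:C)^-1)) =
  n%:R^-1 * \sum_(i < n) v i / (z - (x i)%:C).
Proof.
move=> zx H.
have n0 : n%:R != 0 :> R[i] by rewrite pnatr_eq0.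
have uE i : u i = v i / (z - (x i)%:C) - ubar * (z / (z - (x i)%:C) - 1).
  have zi : z - (x i)%:C != 0 by rewrite subr_eq0.
  have : \sum_j (Q i j)%:C * u j = (x i)%:C * (ubar - u i).
    under eq_bigr => j _ do rewrite trap_generatorE rmorphB rmorphMn /= mulrBl.
    rewrite sumrB /ubar mulrBr; congr (_ - _).
      by rewrite -mulr_sumr rmorphM fmorphV rmorph_nat mulrA.
    rewrite (bigD1 i)//= eqxx mulr1n big1 ?addr0// => j /negbTE ji.
    by rewrite eq_sym ji mulr0n mul0r.
  by rewrite -(H i) => ->; field.
have : ubar = n%:R^-1 * \sum_i u i by [].
under [in X in _ = X]eq_bigr do rewrite uE.
rewrite sumrB mulrBr -mulr_sumr sumrB sumr_const card_ord -mulr_sumr => /eqP.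
rewrite -subr_eq0 => /eqP e.
set A := \sum_(i < n) v i / _ in e *; set B := \sum_(i < n) (z - _)^-1 in e *.
apply/eqP; rewrite -subr_eq0; apply/eqP; rewrite -[RHS]e; field.
by rewrite -natr1 addrC in n0.
Qed.

(** The semigroup and the resolvent are averaged with the same weights [w] on the
    eigenvalues. This ties the probabilities of the chain, a combination of
    exponentials, to the explicit ratio of empirical Stieltjes transforms. *)
Lemma trap_semigroup (v : 'I_n -> R) : exists (l : 'I_n -> R) (w : 'I_n -> R[i]),
  [/\ forall j, l j \in `[0, 1],
    forall t, (n%:R^-1 * \sum_a \sum_b expmx (t *: Q) a b * v b)%:C =
       \sum_j w j * (expR (- (t * l j)))%:C &
    forall z, (forall y : R, y \in `[0, 1] -> z != y%:C) ->
      (n%:R^-1 * \sum_(i < n) (z - (x i)%:C)^-1) != 0 ->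
      (n%:R^-1 * \sum_(i < n) (v i)%:C / (z - (x i)%:C)) /
      (z * (n%:R^-1 * \sum_(i < n) (z - (x i)%:C)^-1)) =
      \sum_j w j / (z - (l j)%:C)].
Proof.
have [V [l [Vu l01 QV]]] := trap_generator_spectral.
pose w j := n%:R^-1 * \sum_a invmx V a j * (\sum_b V j b * (v b)%:C).
exists l, w; split.
- by move=> j; rewrite in_itv/=; exact: l01.
- move=> t; rewrite rmorphM fmorphV rmorph_nat /w.
  under [RHS]eq_bigr do rewrite -mulrA mulr_suml.
  rewrite -mulr_sumr [in RHS]exchange_big /=; congr (_ * _).
  rewrite rmorph_sum; apply: eq_bigr => a _.
  rewrite rmorph_sum /=.
  under eq_bigr do rewrite rmorphM /= (expmx_entry Vu QV) mulr_suml.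
  rewrite [LHS]exchange_big /=; apply: eq_bigr => j _.
  by rewrite mulr_sumr mulr_suml; apply: eq_bigr => b _; ring.
move=> z z01 G0.
have zl j : z - (l j)%:C != 0 by rewrite subr_eq0 z01// in_itv/=; exact: l01.
have zx (i : 'I_n) : z != (x i)%:C.
  by apply: z01; rewrite in_itv/=; case/andP: (x01 i) => /ltW -> ->.
have z0 : z != 0 by rewrite -[0]/(0%:C) z01// in_itv/= lexx ler01.
(* the solution of (- z - Q) u = v, so that - u solves (z + Q) u = v *)
pose u i := \sum_j invmx V i j * (\sum_b V j b * (v b)%:C) / (- z - - (l j)%:C).
have zd j : - z - - (l j)%:C != 0 by rewrite -opprD oppr_eq0.
have Hu := diagonalized_resolvent (fun b => (v b)%:C) Vu QV zd.
rewrite -/u in Hu.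
have ubarE : n%:R^-1 * \sum_i - u i = \sum_j w j / (z - (l j)%:C).
  rewrite /w; under [RHS]eq_bigr do rewrite -mulrA mulr_suml.
  rewrite -mulr_sumr [in RHS]exchange_big /=; congr (_ * _).
  apply: eq_bigr => a _; rewrite /u -sumrN; apply: eq_bigr => j _.
  by rewrite -opprD invrN mulrN opprK.
rewrite -ubarE -(@trap_resolvent _ (fun i => - u i) z zx).
  by rewrite mulfK// mulf_neq0.
move=> i; rewrite -(Hu i) mulrN mulNr; congr (_ + _).
by rewrite -sumrN; apply: eq_bigr => j _; rewrite [in RHS]mxE mulrN.
Qed.

End trap_generator.

(** * Staying probability of a Markov chain *)

Lemma cvgr_sum (R : realType) I (r : seq I) (f : I -> nat -> R) (l : I -> R) :
  (forall i, f i n @[n --> \oo] --> l i) ->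
  \sum_(i <- r) f i n @[n --> \oo] --> \sum_(i <- r) l i.
Proof.
by move=> fl; apply: cvg_big => // x; exact: add_continuous.
Qed.

(** Compares [a m] with exp(q / (m + 1)), whose (m + 1)-th power is exp q. *)
Lemma cvg_pow_expR (R : realType) (a : nat -> R) (q : R) :
  (forall m, `|a m| <= 1) ->
  m.+1%:R * (a m - 1) @[m --> \oo] --> q ->
  a m ^+ m.+1 @[m --> \oo] --> expR q.
Proof.
move=> a1 aq.
pose b m := expR (q / m.+1%:R).
have H m : `|a m ^+ m.+1 - expR q| <= expR `|q| * `|m.+1%:R * (a m - 1) - m.+1%:R * (b m - 1)|.
  rewrite -{1}(expR_div_succ q m) -/(b m); pose c := expR (`|q| / m.+1%:R).
  have c1 : 1 <= c by rewrite /c -expR0 ler_expR divr_ge0.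
  have bc : `|b m| <= c.
    rewrite ger0_norm ?expR_ge0// ler_expR ler_pM2r ?invr_gt0//; exact: ler_norm.
  have := ler_norm_subrXX m (le_trans (a1 m) c1) bc.
  move=> /le_trans; apply.
  have -> : m.+1%:R * (a m - 1) - m.+1%:R * (b m - 1) = m.+1%:R * (a m - b m) by ring.
  rewrite normrM normr_nat -[leLHS]mulrA mulrCA ler_wpM2r ?mulr_ge0//.
  rewrite -(expR_div_succ _ m) -/c exprS ler_peMl// exprn_ge0//.
  exact: le_trans c1.
apply/subr_cvg0.
apply/norm_cvg0P.
apply: (@squeeze_cvgr _ _ _ _ (cst 0)
  (fun m => expR `|q| * `|m.+1%:R * (a m - 1) - m.+1%:R * (b m - 1)|)).
- by apply: nearW => n; rewrite normr_ge0 H.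
- exact: cvg_cst.
- rewrite -(mulr0 (expR `|q|)); apply: cvgM; first exact: cvg_cst.
  rewrite -(normr0 R) -(subrr q); apply: cvg_norm; apply: cvgB => //.
  exact: cvg_succ_expR.
Qed.

Section markov.
Context {R : realType} {d : measure_display} {T : measurableType d}.
Variables (P : probability T R) (n : nat).
Variables (mu0 : 'I_n -> R) (r : 'I_n -> 'I_n -> R) (Y : R -> T -> 'I_n).
Hypothesis mu0_gt0 : forall i, 0 < mu0 i.
Hypothesis MC : is_markov_chain P mu0 r Y.
Local Notation Q := (rate_generator r).

Lemma measurable_state t i : 0 <= t -> measurable (Y t @^-1` [set i]).
Proof. by case: MC => + _ _; exact. Qed.

Lemma measurable_path (m : nat) (t : nat -> R) (i : nat -> 'I_n) :
  (forall k, 0 <= t k) ->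
  measurable [set w | forall k, (k <= m)%N -> Y (t k) w = i k].
Proof.
move=> t0.
rewrite (_ : [set w | _] = \bigcap_(k in `I_m.+1) (Y (t k) @^-1` [set i k])).
  by apply: fin_bigcap_measurable => // k _; exact: measurable_state.
by apply/seteqP; split => w /= h k /=; [move=> km; apply: h|move=> km; apply: h].
Qed.

(** The state at one time splits an event into finitely many pieces. *)
Lemma partition_state (B : set T) s : measurable B -> 0 <= s ->
  P B = (\sum_(i < n) P (B `&` Y s @^-1` [set i]))%E.
Proof.
move=> mB s0.
have mF (i : 'I_n) : measurable (B `&` Y s @^-1` [set i]).
  by apply: measurableI => //; exact: measurable_state.
rewrite -measure_semi_additive_ord//.
- congr (P _); rewrite -bigcup_pred; apply/seteqP; split => w /=.
    by move=> Bw; exists (Y s w).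
  by move=> [i _ []].
- by apply/trivIsetP => i j _ _ ij; apply/seteqP; split => // w [[_ /= yi] [_ /= yj]];
    move: ij; rewrite -yi -yj eqxx.
- exact: bigsetU_measurable.
Qed.

(** The entry is the probability of being in state i at time h when starting in
    i, up to the positive mass of i under the initial law. *)
Lemma expmx_diag_le1 h i : 0 <= h -> `|expmx (h *: Q) i i| <= 1.
Proof.
move=> h0; have [_ _ fdd] := MC.
pose t k : R := if k is 0%N then 0 else h.
have t0 k : 0 <= t k by case: k.
have th : {homo t : a b / (a <= b)%N >-> a <= b} by move=> [|a] [|b].
have := fdd 0%N t (fun=> i) erefl th; rewrite big_ord0 mulr1 => P0.
have := fdd 1%N t (fun=> i) erefl th; rewrite big_ord1 /= subr0 => P1.
have p1 : 0 <= mu0 i * expmx (h *: Q) i i.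
  by rewrite -lee_fin -P1 measure_ge0.
have p2 : mu0 i * expmx (h *: Q) i i <= mu0 i.
  rewrite -lee_fin -P1 -P0; apply: le_measure; rewrite ?inE; try exact: measurable_path.
  by move=> w /= H k k0; apply: H; rewrite (leq_trans k0).
rewrite ger0_norm; last by rewrite pmulr_rge0// in p1.
by rewrite -(ler_pM2l (mu0_gt0 i)) mulr1.
Qed.

Section stay.
Variables (t tw : R).
Hypothesis t_ge0 : 0 <= t.
Hypothesis tw_ge0 : 0 <= tw.

(** Dyadic grids are nested, so that these events decrease to the event of
    staying on the whole time interval. *)
Definition grid_stay M := [set w | forall k, (k <= 2 ^ M)%N ->
  Y (tw + k%:R * (t / (2 ^ M)%:R)) w = Y tw w].

Let grid M k : R := if k is k'.+1 then tw + k'%:R * (t / (2 ^ M)%:R) else 0.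

Lemma grid_ge0 M k : 0 <= grid M k.
Proof. by case: k => //= k; rewrite addr_ge0// mulr_ge0// divr_ge0. Qed.

Lemma grid_homo M : {homo grid M : a b / (a <= b)%N >-> a <= b}.
Proof.
move=> [|a] [|b]//= ab; first exact: (grid_ge0 M b.+1).
by rewrite lerD2l ler_wpM2r ?divr_ge0// ler_nat.
Qed.

Let path_event M j i := [set w | forall k, (k <= (2 ^ M).+1)%N ->
  Y (grid M k) w = (if k is _.+1 then i else j)].

Lemma grid_stay_cut M j i :
  grid_stay M `&` Y tw @^-1` [set i] `&` Y 0 @^-1` [set j] = path_event M j i.
Proof.
apply/seteqP; split => w /=.
  by move=> [[H ywi] y0] [|k] //= km; rewrite H.
move=> H; have H0 := H 0%N isT; have := H 1%N isT; rewrite /= mul0r addr0 => H1.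
by split => //; split => // k km; rewrite H1; exact: (H k.+1).
Qed.

Lemma path_event_prob M j i : P (path_event M j i) =
  (mu0 j * (expmx (tw *: Q) j i * expmx ((t / (2 ^ M)%:R) *: Q) i i ^+ (2 ^ M)))%:E.
Proof.
have [_ _ fdd] := MC.
rewrite (fdd _ _ (fun k => if k is _.+1 then i else j) _ (grid_homo M))//.
congr (_%:E); congr (_ * _); rewrite big_ord_recl /= mul0r addr0 subr0; congr (_ * _).
rewrite -[X in _ ^+ X](card_ord (2 ^ M)) -prodr_const.
move: (t / _) => h; apply: eq_bigr => k _; rewrite /bump /= add1n -natr1.
have -> : tw + (k%:R + 1) * h - (tw + k%:R * h) = h by ring.
by [].
Qed.

Lemma grid_stayE M : grid_stay M =
  \big[setU/set0]_(i < n) \big[setU/set0]_(j < n) path_event M j i.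
Proof.
rewrite -bigcup_pred; apply/seteqP; split => w /=.
  move=> H; exists (Y tw w) => //; rewrite -bigcup_pred; exists (Y 0 w) => //.
  by rewrite -grid_stay_cut.
by move=> [i _]; rewrite -bigcup_pred => -[j _]; rewrite -grid_stay_cut => -[[]].
Qed.

Lemma measurable_grid_stay M : measurable (grid_stay M).
Proof.
rewrite grid_stayE; apply: bigsetU_measurable => i _.
apply: bigsetU_measurable => j _; apply: measurable_path; exact: grid_ge0.
Qed.

Lemma grid_stay_prob M : P (grid_stay M) =
  (\sum_i \sum_j (mu0 j * (expmx (tw *: Q) j i *
     expmx ((t / (2 ^ M)%:R) *: Q) i i ^+ (2 ^ M))))%:E.
Proof.
have mi i : measurable (grid_stay M `&` Y tw @^-1` [set i]).
  by apply: measurableI; [exact: measurable_grid_stay|exact: measurable_state].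
rewrite (partition_state (measurable_grid_stay M) tw_ge0) -sumEFin; apply: eq_bigr => i _.
rewrite (partition_state (mi i) (lexx 0)) -sumEFin; apply: eq_bigr => j _.
by rewrite grid_stay_cut path_event_prob.
Qed.

Lemma grid_stay_decr : nonincreasing_seq grid_stay.
Proof.
move=> M K MK; apply/subsetPset => w H k kM.
have e : (2 ^ K = 2 ^ (K - M) * 2 ^ M)%N by rewrite -expnD subnK.
have := H (k * 2 ^ (K - M))%N.
rewrite [X in (_ <= X)%N]e mulnC leq_mul2l kM orbT => /(_ isT) <-.
have p0 a : (2 ^ a)%:R != 0 :> R by rewrite pnatr_eq0 expn_eq0.
congr (Y _ w); congr (tw + _); rewrite e !natrM.
have := p0 M; have := p0 (K - M)%N; move: ((2 ^ M)%:R) ((2 ^ (K - M))%:R) => a b b0 a0.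
by field; rewrite a0 b0.
Qed.

(** By right continuity: just after any time s before the end there is a point of
    a fine enough grid at which the state is still the one at s. *)
Lemma stay_eq_grid :
  [set w | forall s, tw <= s <= tw + t -> Y s w = Y tw w] = \bigcap_M grid_stay M.
Proof.
apply/seteqP; split => w /= H.
  move=> M _ k kM; apply: H; rewrite lerDl mulr_ge0 ?divr_ge0//= lerD2l.
  rewrite mulrCA ler_piMr// ler_pdivrMr ?mul1r ?ler_nat// ltr0n expn_gt0//.
move=> s /andP[tws]; rewrite le_eqVlt => /predU1P[->|st].
  by have := H 0%N Logic.I 1%N isT; rewrite expn0 mul1r divr1.
have t0 : 0 < t by move: (le_lt_trans tws st); rewrite ltrDl.
have [_ rc _] := MC.
have /nbhs_ballP[e /= e0 He] := rc w s (le_trans tw_ge0 tws).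
(* mesh finer than the interval of constancy after s; k is the first grid
   point beyond s *)
have [M Me] : exists M, t / (2 ^ M)%:R < e.
  exists (Num.truncn (t / e)).
  rewrite ltr_pdivrMr ?ltr0n ?expn_gt0// mulrC -ltr_pdivrMr//.
  apply: (lt_le_trans (truncnS_gt _)); rewrite ler_nat ltn_expl//.
pose h := t / (2 ^ M)%:R; have h0 : 0 < h by rewrite divr_gt0// ltr0n expn_gt0.
pose k := (Num.truncn ((s - tw) / h)).+1.
have kgt : s < tw + k%:R * h.
  by rewrite -ltrBlDl -ltr_pdivrMr// truncnS_gt.
have kle : tw + k%:R * h <= s + h.
  rewrite /k -natr1 mulrDl mul1r addrA lerD2r -lerBrDl -ler_pdivlMr//.
  by rewrite truncn_le divr_ge0 ?subr_ge0// ltW.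
have k2M : (k <= 2 ^ M)%N.
  rewrite -(ltr_nat R) (le_lt_trans (_ : _ <= (s - tw) / h))//.
    by rewrite truncn_le divr_ge0 ?subr_ge0// ltW.
  by rewrite ltr_pdivrMr// /h mulrC divfK ?ltrBlDl// pnatr_eq0 expn_eq0.
rewrite -(H M Logic.I k k2M) -/h; symmetry; apply: He => //.
rewrite /ball /= ltr_norml; move: kgt kle (Me : h < e).
move: (tw + k%:R * h) => u su; move: h {h0 k2M k} su => h su uh he.
by apply/andP; split; lra.
Qed.

(** The probability of the grid events is a power of a diagonal entry of the
    semigroup over a short time, which converges to the exponential of the
    diagonal entry of the generator. *)
Theorem stay_probabilityE :
  (forall i, m.+1%:R * (expmx ((t / m.+1%:R) *: Q) i i - 1) @[m --> \oo] --> t * Q i i) ->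
  stay_probability P Y t tw =
  \sum_i \sum_j (mu0 j * (expmx (tw *: Q) j i * expR (t * Q i i))).
Proof.
move=> dQ.
have lim1 : (fun M => \sum_i \sum_j (mu0 j * (expmx (tw *: Q) j i *
     expmx ((t / (2 ^ M)%:R) *: Q) i i ^+ (2 ^ M)))) @ \oo -->
   \sum_i \sum_j (mu0 j * (expmx (tw *: Q) j i * expR (t * Q i i))).
  apply: cvgr_sum => i; apply: cvgr_sum => j.
  apply: cvgM; first exact: cvg_cst.
  apply: cvgM; first exact: cvg_cst.
  have := @cvg_pow_expR _ (fun m => expmx ((t / m.+1%:R) *: Q) i i) _ _ (dQ i).
  have a1 m : `|expmx ((t / m.+1%:R) *: Q) i i| <= 1.
    by apply: expmx_diag_le1; rewrite divr_ge0.
  move=> /(_ a1) h.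
  (* the powers converge along all integers, hence along powers of 2 *)
  have p2 : (2 ^ M).-1 @[M --> \oo] --> \oo.
    apply/cvgnyPge => A; near=> M.
    rewrite -ltnS prednK ?expn_gt0//; apply: (@leq_trans M.+1); last exact: ltn_expl.
    by rewrite ltnS; near: M; exact: nbhs_infty_ge.
  have := cvg_comp _ _ p2 h; apply: cvg_trans; apply: near_eq_cvg; apply: nearW => M /=.
  by rewrite prednK// expn_gt0.
have lim2 : fine (P (grid_stay M)) @[M --> \oo] --> stay_probability P Y t tw.
  rewrite /stay_probability stay_eq_grid; apply: fine_cvg.
  rewrite fineK; last first.
    apply: fin_num_measure; apply: bigcap_measurableType => M _.
    exact: measurable_grid_stay.
  apply: nonincreasing_cvg_mu.
  - by rewrite (le_lt_trans (probability_le1 P _)) ?ltry//; exact: measurable_grid_stay.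
  - exact: measurable_grid_stay.
  - by apply: bigcap_measurableType => M _; exact: measurable_grid_stay.
  - exact: grid_stay_decr.
apply: cvg_unique lim2 _ => //.
by apply: cvg_trans lim1; apply: near_eq_cvg; apply: nearW => M; rewrite grid_stay_prob.
Unshelve. all: by end_near. Qed.

End stay.
End markov.

(** * Strong law of large numbers for frequencies *)

(** Between two consecutive squares a nondecreasing sequence is controlled by its
    values at the squares, and the ratio of consecutive squares tends to 1. *)
Lemma cvg_interpolate_squares (R : realType) (S : nat -> R) (p : R) :
  (forall n, 0 <= S n) -> {homo S : m n / (m <= n)%N >-> m <= n} ->
  S (k.+1 ^ 2)%N / k.+1%:R ^+ 2 @[k --> \oo] --> p ->
  S n.+1 / n.+1%:R @[n --> \oo] --> p.
Proof.
move=> S0 Smono Sp.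
(* [kn n] is the integer square root of n + 1. *)
pose kn n : nat := Num.truncn (Num.sqrt (n.+1%:R : R)).
have kn1 n : (0 < kn n)%N.
  by rewrite /kn truncn_gt0 -[leLHS]sqrtr1 ler_sqrt// ler1n.
have knlo n : (kn n ^ 2 <= n.+1)%N.
  have := truncn_le (Num.sqrt (n.+1%:R : R)); rewrite sqrtr_ge0 => h.
  by rewrite -(ler_nat R) natrX -[leRHS]sqr_sqrtr// lerXn2r ?nnegrE ?sqrtr_ge0.
have knhi n : (n.+1 < (kn n).+1 ^ 2)%N.
  have := truncnS_gt (Num.sqrt (n.+1%:R : R)) => h.
  by rewrite -(ltr_nat R) natrX -[ltLHS]sqr_sqrtr// ltr_pXn2r ?nnegrE ?sqrtr_ge0.
have knoo : (kn n).-1 @[n --> \oo] --> \oo.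
  apply/cvgnyPge => A; near=> n.
  have An : ((A.+1) ^ 2 <= n.+1)%N.
    by apply: leqW; near: n; exact: nbhs_infty_ge.
  rewrite -ltnS prednK// -ltnS -(ltn_exp2r _ _ (isT : (0 < 2)%N)).
  exact: leq_ltn_trans (knhi n).
pose a k := S (k.+1 ^ 2)%N / k.+1%:R ^+ 2.
pose q k : R := (k.+1%:R / k.+2%:R) ^+ 2.
have q1 : q k @[k --> \oo] --> (1 : R).
  rewrite -(expr1n R 2); apply: (@cvg_comp _ _ _ _ (fun x : R => x ^+ 2) _ (nbhs (1 : R)));
    last exact: exprn_continuous.
  have -> : (fun k => k.+1%:R / k.+2%:R : R) = (fun k => 1 - (k.+2%:R)^-1).
    apply/funext => k; have k0 : k.+2%:R != 0 :> R by rewrite pnatr_eq0.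
    by apply: (mulIf k0); rewrite divfK// mulrBl mulVf// mul1r -[k.+2%:R]natr1 addrK.
  have h : (k.+2%:R^-1 : R) @[k --> \oo] --> (0 : R).
    by have := @cvg_harmonic R; rewrite -cvg_shiftS.
  by have := cvgB (@cvg_cst _ (1 : R) _ _ _) h; rewrite subr0; apply.
have lo : a k * q k @[k --> \oo] --> p.
  by rewrite -[p]mulr1; apply: cvgM.
have hi : a k.+1 / q k @[k --> \oo] --> p.
  rewrite -[p]mulr1 -invr1; apply: cvgM; first by rewrite (cvg_shiftS a).
  exact: cvgV.
apply: (@squeeze_cvgr _ _ _ _ (fun n => a (kn n).-1 * q (kn n).-1)
  (fun n => a (kn n).-1.+1 / q (kn n).-1)).
- apply: nearW => n; rewrite /a /q prednK//.
  have := kn1 n; have := knlo n; have := ltnW (knhi n); move: (kn n) => k hi' lo' k1.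
  have k0 : k%:R != 0 :> R by rewrite pnatr_eq0 -lt0n.
  have k10 : k.+1%:R != 0 :> R by rewrite pnatr_eq0.
  have -> : S (k ^ 2)%N / k%:R ^+ 2 * (k%:R / k.+1%:R) ^+ 2 = S (k ^ 2)%N / k.+1%:R ^+ 2.
    by move: k%:R k.+1%:R (S _) k0 k10 => b c s b0 c0; field; rewrite ?b0 ?c0.
  have -> : S (k.+1 ^ 2)%N / k.+1%:R ^+ 2 / (k%:R / k.+1%:R) ^+ 2 = S (k.+1 ^ 2)%N / k%:R ^+ 2.
    by move: k%:R k.+1%:R (S _) k0 k10 => b c s b0 c0; field; rewrite ?b0 ?c0.
  apply/andP; split; apply: ler_pM; rewrite ?invr_ge0 ?exprn_ge0 ?Smono//.
  - by rewrite lef_pV2 ?posrE ?exprn_gt0 ?ltr0n// -natrX ler_nat.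
  - by rewrite lef_pV2 ?posrE ?exprn_gt0 ?ltr0n// -natrX ler_nat.
- exact: (cvg_comp _ _ knoo lo).
- exact: (cvg_comp _ _ knoo hi).
Unshelve. all: by end_near. Qed.

Section law_of_large_numbers.
Context {R : realType} {d : measure_display} {T : measurableType d}.
Variable P : probability T R.

Definition bmeas (f : T -> R) :=
  measurable_fun setT f /\ exists M, forall w, `|f w| <= M.

Lemma bmeas_integrable f : bmeas f -> P.-integrable setT (EFin \o f).
Proof.
move=> [mf [M fM]]; apply: measurable_bounded_integrable => //.
  by rewrite (le_lt_trans (probability_le1 P _)) ?ltry.
exists M; split; rewrite ?num_real// => z Mz w _ /=.
exact/ltW/(le_lt_trans (fM w)).
Qed.

Lemma bmeas_cst r : bmeas (cst r).
Proof. by split; [exact: measurable_cst|exists `|r|]. Qed.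

Lemma bmeas_indic A : measurable A -> bmeas \1_A.
Proof.
move=> mA; split; first exact: measurable_indic.
by exists 1 => w; rewrite indicE; case: (w \in A); rewrite ?normr1 ?normr0.
Qed.

Lemma bmeasD f g : bmeas f -> bmeas g -> bmeas (fun w => f w + g w).
Proof.
move=> [mf [M fM]] [mg [K gK]]; split; first exact: measurable_funD.
by exists (M + K) => w; rewrite (le_trans (ler_normD _ _))// lerD.
Qed.

Lemma bmeasM f g : bmeas f -> bmeas g -> bmeas (fun w => f w * g w).
Proof.
move=> [mf [M fM]] [mg [K gK]]; split; first exact: measurable_funM.
by exists (M * K) => w; rewrite normrM ler_pM.
Qed.

Lemma bmeas_sum I (s : seq I) (F : I -> T -> R) :
  (forall i, bmeas (F i)) -> bmeas (fun w => \sum_(i <- s) F i w).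
Proof.
move=> bF; elim: s => [|i s ih].
  by under [X in bmeas X]eq_fun do rewrite big_nil; exact: bmeas_cst.
by under [X in bmeas X]eq_fun do rewrite big_cons; exact: bmeasD.
Qed.

Local Notation E f := (\int[P]_w f w)%R.

Lemma mean_sum I (s : seq I) (F : I -> T -> R) :
  (forall i, bmeas (F i)) -> E (fun w => \sum_(i <- s) F i w) = \sum_(i <- s) E (F i).
Proof.
move=> bF; elim: s => [|i s ih].
  under [X in Rintegral _ _ X]eq_fun do rewrite big_nil.
  by rewrite big_nil Rintegral_cst// mul0r.
under [X in Rintegral _ _ X]eq_fun do rewrite big_cons.
rewrite big_cons -ih RintegralD//; apply: bmeas_integrable => //.
exact: bmeas_sum.
Qed.

Lemma mean_cst r : E (cst r) = r.
Proof.
rewrite Rintegral_cst//.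
exact: etrans (congr1 ( *%R r \o fine) (probability_setT P)) (mulr1 r).
Qed.

Lemma mean_indic A : measurable A -> E (\1_A) = fine (P A).
Proof. by move=> mA; rewrite /Rintegral integral_indic// setIT. Qed.

Variables (A : nat -> set T) (p : R).
Hypothesis mA : forall i, measurable (A i).
Hypothesis PA : forall i, P (A i) = p%:E.
Hypothesis PAI : forall i j, i != j -> P (A i `&` A j) = (p * p)%:E.

Let X i w := \1_(A i) w - p.

Lemma bmeas_centered i : bmeas (X i).
Proof. by apply: bmeasD; [exact: bmeas_indic|exact: bmeas_cst]. Qed.

(** Pairwise independence makes the centered indicators orthogonal. *)
Lemma mean_centeredM i j : E (fun w => X i w * X j w) = if i == j then p - p * p else 0.
Proof.
have e w : X i w * X j w = \1_(A i `&` A j) w + (- p) * \1_(A i) w +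
    (- p) * \1_(A j) w + p * p.
  by rewrite /X indicI /=; ring.
have bI := bmeas_integrable.
have bi k : bmeas (\1_(A k)) by exact: bmeas_indic.
have bij : bmeas (\1_(A i `&` A j)) by apply: bmeas_indic; exact: measurableI.
have bc := bmeas_cst.
have bZ k : bmeas (fun w => (- p) * \1_(A k) w) by exact: bmeasM (bc (- p)) (bi k).
under [X in Rintegral _ _ X]eq_fun do rewrite e.
rewrite RintegralD//; last 2 first.
- exact: bI (bmeasD (bmeasD bij (bZ i)) (bZ j)).
- exact: bI (bc (p * p)).
rewrite RintegralD//; last 2 first.
- exact: bI (bmeasD bij (bZ i)).
- exact: bI (bZ j).
rewrite RintegralD//; last 2 first.
- exact: bI.
- exact: bI (bZ i).
rewrite (mean_cst (p * p)) !RintegralZl//; try exact: bI.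
rewrite !mean_indic//; last exact: measurableI.
rewrite !PA /=.
case: eqVneq => [<-|ij]; first by rewrite setIid PA /=; ring.
by rewrite PAI//=; ring.
Qed.

Let dev n w := \sum_(i < n) X i w.

Lemma mean_sqr_sum n : E (fun w => dev n w ^+ 2) <= n%:R.
Proof.
have e w : dev n w ^+ 2 = \sum_(i < n) \sum_(j < n) X i w * X j w.
  by rewrite expr2 mulr_suml; apply: eq_bigr => i _; rewrite mulr_sumr.
under [X in Rintegral _ _ X]eq_fun do rewrite e.
have b (i j : 'I_n) : bmeas (fun w => X i w * X j w).
  by apply: bmeasM; exact: bmeas_centered.
rewrite mean_sum; last by move=> i; exact: bmeas_sum.
have -> : n%:R = \sum_(i < n) (1 : R) by rewrite sumr_const card_ord.
apply: ler_sum => i _; rewrite mean_sum//.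
rewrite (bigD1 i)//= big1 ?addr0; last first.
  by move=> j ji; rewrite mean_centeredM eq_sym -[_ == _]/(j == i) (negbTE ji).
rewrite mean_centeredM eqxx.
have p0 : 0 <= p by rewrite -lee_fin -(PA 0%N).
have p1 : p <= 1 by rewrite -lee_fin -(PA 0%N) probability_le1.
nra.
Qed.

Let sqdev k w := (dev (k.+1 ^ 2) w / k.+1%:R ^+ 2) ^+ 2.

Lemma bmeas_sqdev k : bmeas (sqdev k).
Proof.
have b : bmeas (fun w => dev (k.+1 ^ 2) w / k.+1%:R ^+ 2).
  apply: bmeasM; last exact: bmeas_cst.
  by apply: bmeas_sum => i; exact: bmeas_centered.
exact: (bmeasM b b).
Qed.

(** The variance of a frequency over m trials is at most 1/m; along m = (k + 1)^2
    this is summable. *)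
Lemma integral_sqdev_le k : (\int[P]_w (sqdev k w)%:E <= (k.+1%:R ^- 2)%:E)%E.
Proof.
have bdev : bmeas (fun w => dev (k.+1 ^ 2) w ^+ 2).
  have b : bmeas (dev (k.+1 ^ 2)) by apply: bmeas_sum => i; exact: bmeas_centered.
  exact: (bmeasM b b).
have k0 : 0 < k.+1%:R :> R by rewrite ltr0n.
rewrite -[leLHS]fineK; last first.
  by apply: integrable_fin_num => //; apply: bmeas_integrable; exact: bmeas_sqdev.
rewrite lee_fin -/(Rintegral _ _ _).
have -> : E (sqdev k) = (k.+1%:R ^- 2) ^+ 2 * E (fun w => dev (k.+1 ^ 2) w ^+ 2).
  rewrite -RintegralZl//; last exact: bmeas_integrable.
  by apply: eq_Rintegral => w _; rewrite /sqdev exprMn mulrC.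
rewrite expr2 -mulrA; apply: ler_piMr; first by rewrite invr_ge0 exprn_ge0 ?ltW.
rewrite ler_pdivrMl ?exprn_gt0// mulr1 -natrX.
exact: mean_sqr_sum.
Qed.

(** Telescoping: 1/k^2 is at most 1/(k - 1) - 1/k. *)
Lemma sum_inv_sqr K : \sum_(k < K.+1) (k.+1%:R ^- 2 : R) <= 2 - K.+1%:R^-1.
Proof.
elim: K => [|K ih]; first by rewrite big_ord1 expr1n invr1; lra.
rewrite big_ord_recr /=; apply: le_trans (lerD ih (lexx _)) _.
have a0 : 0 < K.+1%:R :> R by rewrite ltr0n.
rewrite -[K.+2%:R]natr1; move: (K.+1%:R) a0 => a a0.
have a10 : 0 < a + 1 by lra.
rewrite -addrA lerD2l -subr_ge0.
have -> : - (a + 1)^-1 - (- a^-1 + (a + 1) ^- 2) = (a * (a + 1) ^+ 2)^-1.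
  by field; rewrite !gt_eqF.
by rewrite invr_ge0 mulr_ge0 ?exprn_ge0// ltW.
Qed.

(** A nonnegative series with a finite expected sum converges almost surely. *)
Lemma ae_sum_sqdev : {ae P, forall w, (\sum_(0 <= k <oo) (sqdev k w)%:E)%E \is a fin_num}.
Proof.
have msq k : measurable_fun setT (fun w => (sqdev k w)%:E).
  by apply/measurable_EFinP; case: (bmeas_sqdev k).
have sq0 k w : (0 <= (sqdev k w)%:E)%E by rewrite lee_fin sqr_ge0.
have : P.-integrable setT (fun w => \sum_(0 <= k <oo) (sqdev k w)%:E)%E.
  apply/integrableP; split; first exact: ge0_emeasurable_sum.
  under eq_integral do rewrite gee0_abs ?nneseries_ge0//.
  rewrite integral_nneseries//.
  apply: (@le_lt_trans _ _ 2%:E); last exact: ltry.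
  apply: lime_le; first by apply: is_cvg_nneseries => k _ _; exact: integral_ge0.
  apply: nearW => -[|K]; first by rewrite big_geq// lee_fin.
  apply: (@le_trans _ _ (\sum_(0 <= k < K.+1) (k.+1%:R ^- 2)%:E)%E).
    by apply: lee_sum => k _; exact: integral_sqdev_le.
  rewrite sumEFin lee_fin big_mkord; apply: le_trans (sum_inv_sqr K) _.
  by rewrite gerBl invr_ge0.
by move=> /(integrable_ae measurableT); apply: filterS => w; exact.
Qed.

(** The terms of the convergent series of squared deviations tend to 0, which
    gives the convergence along the squares; the counts are nondecreasing, so that
    it extends to all indices. *)
Theorem frequency_cvg : {ae P, forall w,
  (\sum_(i < n.+1) \1_(A i) w) / n.+1%:R @[n --> \oo] --> p}.
Proof.
apply: filterS ae_sum_sqdev => w fw.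
have sqw : sqdev k w @[k --> \oo] --> (0 : R).
  apply: cvg_series_cvg_0; apply: nondecreasing_is_cvgn.
    by apply: nondecreasing_series => k _ _; exact: sqr_ge0.
  exists (fine (\sum_(0 <= k <oo) (sqdev k w)%:E)%E) => _ [K _ <-].
  rewrite -lee_fin fineK// /series /= -sumEFin.
  by apply: nneseries_lim_ge => k _ _; rewrite lee_fin sqr_ge0.
have devw : dev (k.+1 ^ 2) w / k.+1%:R ^+ 2 @[k --> \oo] --> (0 : R).
  apply/norm_cvg0P.
  have -> : (fun k => `|dev (k.+1 ^ 2) w / k.+1%:R ^+ 2|) = (fun k => Num.sqrt (sqdev k w)).
    by apply/funext => k; rewrite sqrtr_sqr.
  rewrite -(sqrtr0 R).
  exact: (cvg_comp _ _ sqw (@sqrt_continuous R 0)).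
apply: (@cvg_interpolate_squares _ (fun n => \sum_(i < n) \1_(A i) w)).
- by move=> n; apply: sumr_ge0 => i _.
- move=> m n mn; rewrite -(big_mkord xpredT (fun i => \1_(A i) w)).
  rewrite -(big_mkord xpredT (fun i => \1_(A i) w)) (big_cat_nat _ mn)//=.
  by rewrite lerDl sumr_ge0.
- have : dev (k.+1 ^ 2) w / k.+1%:R ^+ 2 + p @[k --> \oo] --> 0 + p.
    by apply: cvgD => //; exact: cvg_cst.
  rewrite add0r; apply: cvg_trans; apply: near_eq_cvg; apply: nearW => k /=.
  have k0 : k.+1%:R ^+ 2 != 0 :> R by rewrite expf_neq0// pnatr_eq0.
  apply: (mulIf k0); rewrite mulrDl !divfK//.
  rewrite /dev /X sumrB sumr_const card_ord -[p *+ _]mulr_natr natrX; ring.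
Qed.

End law_of_large_numbers.

(** * Empirical averages of Lipschitz functions *)

(** The thresholds are restricted to a countable set so that almost sure statements
    about each of them can be combined. *)
Definition power_frequencies (R : realType) (alpha : R) (x : nat -> R) :=
  forall u : R, (exists M j, (j < M.+1)%N /\ u = j.+1%:R / M.+1%:R) ->
  (\sum_(i < n.+1) ((u <= x i)%R)%:R) / n.+1%:R @[n --> \oo] --> 1 - u `^ alpha.

Section power_law.
Context {R : realType} (alpha : R).
Hypothesis alpha01 : 0 < alpha < 1.
Local Notation mu := (@lebesgue_measure R).
Local Notation D := (`[0, 1]%classic : set R).

Let a0 : 0 < alpha. Proof. by case/andP: alpha01. Qed.

Definition power_density (x : R) := alpha * x `^ (alpha - 1).
Local Notation W := power_density.

Lemma power_density_ge0 x : 0 <= W x.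
Proof. by rewrite mulr_ge0 ?powR_ge0// ltW. Qed.

Lemma measurable_power_density (B : set R) : measurable_fun B W.
Proof.
apply: measurable_funM; first exact: measurable_cst.
by apply: measurable_funTS; exact: measurable_powR.
Qed.

Lemma integral_power_tail (u : R) : 0 < u <= 1 ->
  (\int[mu]_(x in `[u, 1%R]) (W x)%:E)%E = (1 - u `^ alpha)%:E.
Proof.
move=> /andP[u0]; rewrite le_eqVlt => /predU1P[->|u1].
  by rewrite set_itv1 integral_set1 powR1 subrr.
have cp (r x : R) : 0 < x -> {for x, continuous (fun y : R => y `^ r)}.
  move=> x0; apply: differentiable_continuous; apply/derivable1_diffP.
  by apply: derivable_powR; rewrite in_itv/= x0.
rewrite (@continuous_FTC2 _ W (fun x => x `^ alpha))//.
- by rewrite powR1.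
- apply: continuous_in_subspaceT => x; rewrite inE /= in_itv /= => /andP[ux _].
  apply: cvgM; first exact: cvg_cst.
  exact: cp (lt_le_trans u0 ux).
- split.
  + move=> x; rewrite in_itv/= => /andP[ux _]; apply: derivable_powR.
    by rewrite in_itv/= (lt_trans u0 ux).
  + by apply: cvg_at_right_filter; exact: cp.
  + by apply: cvg_at_left_filter; exact: cp.
- move=> x; rewrite in_itv/= => /andP[ux _].
  by rewrite powR_derive1// in_itv/= (lt_trans u0 ux).
Qed.

(** The density is singular at 0: exhaust ]0, 1] by the intervals [1/(k + 1), 1]. *)
Lemma integral_power_density : (\int[mu]_(x in D) (W x)%:E)%E = 1%E.
Proof.
pose F k : set R := `[k.+1%:R^-1, 1]%classic.
have FU : \bigcup_k F k = `]0, 1]%classic.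
  apply/seteqP; split => x.
    move=> [k _]; rewrite /F /= !in_itv/= => /andP[kx ->]; rewrite andbT.
    by apply: lt_le_trans kx; rewrite invr_gt0.
  rewrite /= in_itv/= => /andP[x0 x1]; exists (Num.truncn x^-1) => //.
  rewrite /F /= in_itv/= x1 andbT -[leRHS]invrK lef_pV2 ?posrE ?invr_gt0//.
  exact/ltW/truncnS_gt.
have mW (B : set R) : measurable_fun B (fun x => (W x)%:E).
  by apply/(@measurable_EFinP _ (measurableTypeR R)); exact: measurable_power_density.
have h : (\int[mu]_(x in F k) (W x)%:E)%E @[k --> \oo] -->
    (\int[mu]_(x in \bigcup_k F k) (W x)%:E)%E.
  apply: ge0_nondecreasing_set_cvg_integral => //.
  - move=> m n mn; apply/subsetPset; apply: subset_itvr; rewrite bnd_simp.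
    by rewrite lef_pV2 ?posrE// ler_nat.
  - by move=> k; exact: measurable_itv.
  - by move=> k; exact: mW.
  - by move=> k x _; rewrite lee_fin power_density_ge0.
rewrite -integral_itv_obnd_cbnd// -FU.
apply: (cvg_unique _ h) => //=.
have -> : (fun k => \int[mu]_(x in F k) (W x)%:E)%E = EFin \o (fun k => 1 - (k.+1%:R^-1) `^ alpha).
  apply/funext => k; rewrite integral_power_tail//.
  by rewrite invr_gt0 ltr0n invf_le1 ?ler1n ?ltr0n.
apply: cvg_EFin; first exact: nearW.
rewrite -[X in _ --> X]subr0.
apply: cvgB; first exact: cvg_cst.
have /cvg_at_rightP/(_ (fun k => k.+1%:R^-1)) H := powR_cvg0 a0.
by apply: H; split => [k|]; [rewrite invr_gt0|exact: cvg_harmonic].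
Qed.

Lemma integrable_power_density : mu.-integrable D (EFin \o W).
Proof.
apply/integrableP; split.
  by apply/(@measurable_EFinP _ (measurableTypeR R)); exact: measurable_power_density.
under eq_integral do rewrite gee0_abs ?lee_fin ?power_density_ge0//.
by rewrite integral_power_density ltry.
Qed.

Lemma integrable_power_densityM (h : R -> R) (M : R) : measurable_fun D h ->
  (forall y : R, y \in `[0, 1] -> `|h y| <= M) ->
  mu.-integrable D (EFin \o (fun y => W y * h y)).
Proof.
move=> mh hM.
have iM : mu.-integrable D (EFin \o (fun y => M * W y)).
  exact: (integrableZl _ M integrable_power_density).
apply: le_integrable iM => //.
  apply/(@measurable_EFinP _ (measurableTypeR R)).
  by apply: measurable_funM => //; exact: measurable_power_density.
move=> y Dy /=; rewrite lee_fin [leLHS]normrM [leRHS]normrM [leLHS]mulrC.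
by rewrite ler_wpM2r// (le_trans (hM y Dy))// ler_norm.
Qed.

Lemma Rintegral_power_density : (\int[mu]_(y in D) W y)%R = 1.
Proof. by rewrite /Rintegral integral_power_density. Qed.

Section lipschitz.
Variables (f : R -> R) (L : R).
Hypothesis L0 : 0 <= L.
Hypothesis fL : {in `[0, 1] &, forall y z : R, `|f y - f z| <= L * `|y - z|}.

(** Written as a combination of indicators of [u, 1], whose empirical mean is a
    frequency and whose integral is a tail of the power law; no cell around the
    singularity at 0 occurs. *)
Definition step (M : nat) (y : R) : R := f 0 + \sum_(j < M.+1)
  (f (j.+1%:R / M.+1%:R) - f (j%:R / M.+1%:R)) * ((j.+1%:R / M.+1%:R <= y)%R)%:R.

(** The sum telescopes to the value of [f] at the grid point below y. *)
Lemma step_error M (y : R) : y \in `[0, 1] -> `|f y - step M y| <= L / M.+1%:R.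
Proof.
move=> y01; have := y01; rewrite in_itv/= => /andP[y0 y1].
have m0 : 0 < M.+1%:R :> R by rewrite ltr0n.
pose k := Num.truncn (y * M.+1%:R).
have klo : k%:R <= y * M.+1%:R by rewrite truncn_le mulr_ge0.
have khi : y * M.+1%:R < k.+1%:R by exact: truncnS_gt.
have kM : (k <= M.+1)%N.
  by rewrite -(ler_nat R) (le_trans klo)// ler_piMl// ltW.
have -> : step M y = f (k%:R / M.+1%:R).
  rewrite /step.
  have e (j : 'I_M.+1) : (j.+1%:R / M.+1%:R <= y) = (j < k)%N.
    rewrite ler_pdivrMr//; apply/idP/idP => [jy|jk].
      by rewrite -ltnS -(ltr_nat R) (le_lt_trans jy).
    by apply: le_trans klo; rewrite ler_nat.
  under eq_bigr do rewrite e mulr_natr mulrb.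
  rewrite -big_mkcond /=.
  rewrite -(big_ord_widen _ (fun j => f (j.+1%:R / M.+1%:R) - f (j%:R / M.+1%:R)) kM).
  rewrite -(big_mkord xpredT (fun j => f (j.+1%:R / M.+1%:R) - f (j%:R / M.+1%:R))).
  by rewrite (telescope_sumr (fun j => f (j%:R / M.+1%:R)))// mul0r addrC subrK.
have kin : (k%:R / M.+1%:R : R) \in `[0, 1].
  rewrite in_itv/= divr_ge0//= ler_pdivrMr// mul1r ler_nat//.
apply: le_trans (fL y01 kin) _.
rewrite ler_wpM2l// ger0_norm ?subr_ge0 ?ler_pdivrMr//.
by rewrite lerBlDr -[X in X + _]mul1r -mulrDl nat1r ler_pdivlMr// ltW.
Qed.

Lemma measurable_step M : measurable_fun D (step M).
Proof.
apply: measurable_funD; first exact: measurable_cst.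
apply: measurable_sum => j; apply: measurable_funM; first exact: measurable_cst.
rewrite (_ : (fun y => _) = \1_(`[j.+1%:R / M.+1%:R, +oo[)).
  exact: measurable_indic.
by apply/funext => y; rewrite indicE mem_setE /= in_itv/= andbT.
Qed.

Lemma lipschitz_measurable : measurable_fun D f.
Proof.
apply: (measurable_fun_cvg measurable_step) => y Dy.
apply/cvgrPdist_le => e e0; near=> M.
apply: le_trans (step_error M Dy) _.
rewrite ler_pdivrMr ?ltr0n// mulrC -ler_pdivrMr//.
apply: le_trans (ltW (truncnS_gt _)) _; rewrite ler_nat ltnS.
by near: M; exact: nbhs_infty_ge.
Unshelve. all: by end_near. Qed.

Lemma lipschitz_bounded (y : R) : y \in `[0, 1] -> `|f y| <= `|f 0| + L.
Proof.
move=> y01; rewrite -[f y](subrK (f 0)) (le_trans (ler_normD _ _))// addrC lerD2l.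
have z01 : 0 \in (`[0, 1] : interval R) by rewrite in_itv/= lexx ler01.
apply: le_trans (fL y01 z01) _; rewrite subr0.
by move: y01; rewrite in_itv/= => /andP[y0 y1]; rewrite ler_piMr// ger0_norm.
Qed.

Lemma integrable_lipschitz : mu.-integrable D (EFin \o (fun y => W y * f y)).
Proof. exact: integrable_power_densityM lipschitz_measurable lipschitz_bounded. Qed.

Definition step_mean M := f 0 + \sum_(j < M.+1)
  (f (j.+1%:R / M.+1%:R) - f (j%:R / M.+1%:R)) * (1 - (j.+1%:R / M.+1%:R) `^ alpha).

Lemma integral_step M : (\int[mu]_(y in D) (W y * step M y))%R = step_mean M.
Proof.
pose c (j : nat) := f (j.+1%:R / M.+1%:R) - f (j%:R / M.+1%:R).
pose u (j : nat) : R := j.+1%:R / M.+1%:R.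
pose t j (y : R) : R := ((u j <= y)%R)%:R.
have mt j : measurable_fun D (t j).
  rewrite (_ : t j = \1_(`[u j, +oo[)); first exact: measurable_indic.
  by apply/funext => y; rewrite indicE mem_setE /= in_itv/= andbT.
have t1 j (y : R) : y \in `[0, 1] -> `|t j y| <= 1.
  by move=> _; rewrite /t; case: (u j <= y); rewrite ?normr1 ?normr0.
have it j : mu.-integrable D (EFin \o (fun y => W y * t j y)).
  exact: integrable_power_densityM (mt j) (t1 j).
have tE j : (j < M.+1)%N -> (\int[mu]_(y in D) (W y * t j y))%R = 1 - (u j) `^ alpha.
  move=> jM; have u0 : 0 < u j by rewrite divr_gt0.
  have u1 : u j <= 1 by rewrite ler_pdivrMr// mul1r ler_nat.
  have -> : (\int[mu]_(y in D) (W y * t j y))%R = (\int[mu]_(y in D `&` `[u j, +oo[) W y)%R.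
    rewrite Rintegral_mkcondr; apply: eq_Rintegral => y _.
    by rewrite patchE mem_setE /= in_itv/= andbT /t; case: ifP; rewrite ?mulr1 ?mulr0.
  have -> : D `&` `[u j, +oo[ = `[u j, 1]%classic.
    apply/seteqP; split => y /=; rewrite !in_itv/= ?andbT.
      by move=> [/andP[_ ->] ->].
    by move=> /andP[uy ->]; rewrite uy (le_trans (ltW u0) uy).
  by rewrite /Rintegral integral_power_tail// u0.
have sE (s : seq nat) : (forall j, j \in s -> (j < M.+1)%N) ->
   mu.-integrable D (EFin \o (fun y => W y * \sum_(j <- s) c j * t j y)) /\
   (\int[mu]_(y in D) (W y * \sum_(j <- s) c j * t j y))%R =
   \sum_(j <- s) c j * (1 - (u j) `^ alpha).
  elim: s => [|j s ih] sM.
    have -> : (fun y => W y * \sum_(j <- [::]) c j * t j y) = cst 0.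
      by apply/funext => y; rewrite big_nil mulr0.
    split; last by rewrite big_nil Rintegral_cst// mul0r.
    exact: integrable0.
  have [i1 e1] := ih (fun i hi => sM i (mem_behead (s := j :: s) hi)).
  have i2 : mu.-integrable D (EFin \o (fun y => c j * (W y * t j y))).
    exact: (integrableZl _ (c j) (it j)).
  have -> : (fun y => W y * \sum_(j0 <- j :: s) c j0 * t j0 y) =
     (fun y => c j * (W y * t j y) + W y * \sum_(j <- s) c j * t j y).
    by apply/funext => y; rewrite big_cons; ring.
  split; first exact: (integrableD _ i2 i1).
  rewrite RintegralD// e1 big_cons RintegralZl// tE//.
  by apply: sM; rewrite mem_head.
have [|i1 e1] := sE (index_iota 0 M.+1); first by move=> j; rewrite mem_index_iota.
have i0 : mu.-integrable D (EFin \o (fun y => f 0 * W y)).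
  exact: (integrableZl _ (f 0) integrable_power_density).
rewrite /step_mean -(big_mkord xpredT (fun j => c j * (1 - u j `^ alpha))) -e1.
have e0 : f 0 = (\int[mu]_(y in D) (f 0 * W y))%R.
  by rewrite RintegralZl ?Rintegral_power_density ?mulr1//; exact: integrable_power_density.
rewrite [X in _ = X + _]e0 -RintegralD//; apply: eq_Rintegral => y _.
by rewrite /step -(big_mkord xpredT (fun j => c j * t j y)); ring.
Qed.

Lemma integral_lipschitz_error M :
  `|(\int[mu]_(y in D) (W y * f y))%R - step_mean M| <= L / M.+1%:R.
Proof.
have is_ : mu.-integrable D (EFin \o (fun y => W y * step M y)).
  apply: (integrable_power_densityM (M := `|f 0| + L + L / M.+1%:R)).
    exact: measurable_step.
  move=> y y01; rewrite -[step M y](subKr (f y)) (le_trans (ler_normB _ _))//.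
  by rewrite lerD ?lipschitz_bounded ?step_error.
rewrite -integral_step -RintegralB//; last exact: integrable_lipschitz.
apply: le_trans (le_normr_Rintegral _ _) _ => //.
  exact: (integrableB _ integrable_lipschitz is_).
have iL : mu.-integrable D (EFin \o (fun y => (L / M.+1%:R) * W y)).
  exact: (integrableZl _ _ integrable_power_density).
apply: le_trans (le_Rintegral _ _ iL _) _ => //.
- exact: (integrable_norm (integrableB _ integrable_lipschitz is_)).
- move=> y Dy /=; rewrite -mulrBr normrM ger0_norm ?power_density_ge0// mulrC.
  by rewrite ler_wpM2r ?power_density_ge0// step_error.
- rewrite RintegralZl//; last exact: integrable_power_density.
  by rewrite Rintegral_power_density mulr1.
Qed.

Variable x : nat -> R.
Hypothesis x01 : forall i, x i \in `[0, 1].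
Hypothesis freq : power_frequencies alpha x.

Lemma empirical_step_cvg M :
  (\sum_(i < n.+1) step M (x i)) / n.+1%:R @[n --> \oo] --> step_mean M.
Proof.
have -> : (fun n => (\sum_(i < n.+1) step M (x i)) / n.+1%:R) = (fun n => f 0 +
   \sum_(j < M.+1) (f (j.+1%:R / M.+1%:R) - f (j%:R / M.+1%:R)) *
    ((\sum_(i < n.+1) ((j.+1%:R / M.+1%:R <= x i)%R)%:R) / n.+1%:R)).
  apply/funext => n; rewrite /step big_split /= sumr_const card_ord mulrDl.
  rewrite -[f 0 *+ _]mulr_natr mulfK ?pnatr_eq0//; congr (_ + _).
  rewrite exchange_big /= mulr_suml; apply: eq_bigr => j _.
  by rewrite -mulr_sumr mulrA.
apply: cvgD; first exact: cvg_cst.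
apply: cvgr_sum => j; apply: cvgM; first exact: cvg_cst.
by apply: freq; exists M, j.
Qed.

(** Both the empirical averages and the integral are within L/(M + 1) of the same
    quantities for [step M], and these converge. *)
Lemma empirical_average_cvg :
  (\sum_(i < n.+1) f (x i)) / n.+1%:R @[n --> \oo] --> (\int[mu]_(y in D) (W y * f y))%R.
Proof.
apply/cvgrPdist_le => e e0.
(* three errors, each at most e / 3 *)
pose M := Num.truncn (3 * L / e).
have ML : L / M.+1%:R <= e / 3.
  rewrite ler_pdivrMr ?ltr0n// mulrC -ler_pdivrMr ?divr_gt0// invf_div.
  by rewrite mulrA [L * _]mulrC ltW// truncnS_gt.
have /cvgrPdist_le/(_ (e / 3)) := @empirical_step_cvg M.
rewrite divr_gt0// => /(_ isT); apply: filterS => n h1.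
have h2 := le_trans (integral_lipschitz_error M) ML.
have h3 : `|(\sum_(i < n.+1) f (x i)) / n.+1%:R -
    (\sum_(i < n.+1) step M (x i)) / n.+1%:R| <= e / 3.
  apply: le_trans ML; rewrite -mulrBl -sumrB normrM normfV normr_nat ler_pdivrMr//.
  apply: le_trans (ler_norm_sum _ _ _) _.
  rewrite mulr_natr -[X in _ *+ X]card_ord -sumr_const; apply: ler_sum => i _.
  exact: step_error.
move: h1 h2 h3; move: (Rintegral _ _ _) (step_mean M)
  ((\sum_(i < n.+1) f (x i)) / n.+1%:R)
  ((\sum_(i < n.+1) step M (x i)) / n.+1%:R) => I S A B.
rewrite !ler_norml => /andP[? ?] /andP[? ?] /andP[? ?].
by apply/andP; split; lra.
Qed.

End lipschitz.

End power_law.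

(** * The random traps and the resolvent kernels *)

Section random_traps.
Context {R : realType} (alpha : R) {d : measure_display} {T : measurableType d}.
Variables (P : probability T R) (E : nat -> {RV P >-> R}).
Hypothesis Eind : mutually_independent E.
Hypothesis Eexp : forall (i : nat) (A : set R), measurable A ->
  distribution P (E i) A = exponential_prob alpha A.

Lemma exponential_prob_initial (c : R) : 0 <= c ->
  exponential_prob alpha `[0, c]%classic = (1 - expR (- alpha * c))%:E.
Proof.
rewrite le_eqVlt => /predU1P[<-|c0]; last by rewrite exponential_prob_itv0c// EFinB.
by rewrite /exponential_prob set_itv1 integral_set1 mulr0 expR0 subrr.
Qed.

(** The exponential density vanishes on the negative half-line. *)
Lemma ae_exponential_ge0 : {ae P, forall w, forall i, 0 <= E i w}.
Proof.
apply: ae_foralln => i; exists (E i @^-1` `]-oo, 0[%classic); split.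
- by rewrite -[X in measurable X]setTI; apply: measurable_funPT.
- apply: etrans (Eexp i (measurable_itv `]-oo, 0[)) _.
  rewrite /exponential_prob; apply: integral0_eq => y /=; rewrite in_itv/= => y0.
  by rewrite lt0_exponential_pdf.
- by move=> w /= /negP; rewrite in_itv/= -ltNge.
Qed.

(** The trap exp(- E i) is at least u when E i is at most - ln u, which happens
    with probability 1 - u^alpha. *)
Lemma ae_trap_frequency (u : R) : 0 < u <= 1 -> {ae P, forall w,
  (\sum_(i < n.+1) \1_(E i @^-1` `[0, - ln u]%classic) w) / n.+1%:R @[n --> \oo] -->
  1 - u `^ alpha}.
Proof.
move=> /andP[u0 u1].
have lu : 0 <= - ln u by rewrite oppr_ge0 ln_le0.
pose B : set R := `[0, - ln u]%classic.
have PB i : P (E i @^-1` B) = (1 - u `^ alpha)%:E.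
  apply: etrans (Eexp i (measurable_itv `[0, - ln u])) _.
  by rewrite exponential_prob_initial// mulrNN /powR gt_eqF.
apply: (frequency_cvg (A := fun i => E i @^-1` B)) => //.
- move=> i /=; rewrite -[X in measurable X]setTI.
  by apply: measurable_funPT => //; exact: measurable_itv.
- move=> i j ij; have /(_ [:: i; j] (fun=> B)) := Eind.
  rewrite /= inE ij /= => /(_ isT (fun=> measurable_itv _)).
  by rewrite !big_cons !big_nil setIT mule1 !PB -EFinM.
Qed.

Lemma ae_traps : {ae P, forall w, (forall i, 0 < expR (- E i w) <= 1) /\
  power_frequencies alpha (fun i => expR (- E i w))}.
Proof.
have H : {ae P, forall w, forall M j, (j < M.+1)%N ->
  (\sum_(i < n.+1) \1_(E i @^-1` `[0, - ln (j.+1%:R / M.+1%:R)]%classic) w) / n.+1%:R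
    @[n --> \oo] --> 1 - (j.+1%:R / M.+1%:R) `^ alpha}.
  apply: ae_foralln => M; apply: ae_foralln => j.
  have [jM|] := ltnP j M.+1; last by move=> _; apply: aeW.
  have u01 : 0 < (j.+1%:R / M.+1%:R : R) <= 1.
    by rewrite divr_gt0 ?ltr0n//= ler_pdivrMr// mul1r ler_nat.
  by apply: filterS (ae_trap_frequency u01) => w.
apply: filterS2 ae_exponential_ge0 H => w E0 H; split.
  by move=> i; rewrite expR_gt0 -expR0 ler_expR oppr_le0 E0.
move=> _ [M [j [jM ->]]].
have := H M j jM; apply: cvg_trans; apply: near_eq_cvg; apply: nearW => n /=.
congr (_ / _); apply: eq_bigr => i _.
have memE (c : R) : (w \in E i @^-1` `[0, c]%classic) = (E i w <= c).
  by apply/idP/idP; rewrite inE /= in_itv/= E0.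
rewrite indicE memE lerNr.
have v0 : (j.+1%:R / M.+1%:R : R) \is Num.pos by rewrite posrE divr_gt0.
by rewrite -(ler_expR (ln (j.+1%:R / M.+1%:R))) lnK.
Qed.
End random_traps.

Section kernel.
Context {R : realType} (alpha : R).
Hypothesis alpha01 : 0 < alpha < 1.
Variable x : nat -> R.
Hypothesis x01 : forall i, 0 < x i <= 1.
Hypothesis freq : power_frequencies alpha x.

Definition empirical_mean (n : nat) (F : R -> R[i]) : R[i] :=
  n.+1%:R^-1 * \sum_(i < n.+1) F (x i).

Lemma trap_itv i : x i \in `[0, 1].
Proof. by rewrite in_itv/=; case/andP: (x01 i) => /ltW -> ->. Qed.

Lemma normc_empirical_mean n F (M : R) :
  (forall y : R, y \in `[0, 1] -> normc (F y) <= M) ->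
  normc (empirical_mean n F) <= M.
Proof.
move=> FM; rewrite /empirical_mean mulrC normc_div_nat ler_pdivrMr ?ltr0n//.
apply: (@le_trans _ _ (\sum_(i < n.+1) normc (F (x i)))).
  elim/big_ind2: _ => // [|a b a' b' h h']; first by rewrite Normc.normc0.
  by apply: le_trans (ler_normcD _ _) _; exact: lerD.
rewrite mulr_natr -[X in _ *+ X]card_ord -sumr_const; apply: ler_sum => i _.
by apply: FM; exact: trap_itv.
Qed.

Lemma empirical_mean_cvg (F : R -> R[i]) (L : R) : 0 <= L ->
  {in `[0, 1] &, forall y z : R, normc (F y - F z) <= L * `|y - z|} ->
  ccvg (fun n => empirical_mean n F) (power_expectation alpha F).
Proof.
move=> L0 FL.
have e n : empirical_mean n F =
    ((\sum_(i < n.+1) Re (F (x i))) / n.+1%:R) +i* ((\sum_(i < n.+1) Im (F (x i))) / n.+1%:R).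
  by rewrite /empirical_mean mulrC divc_nat cRe_sum cIm_sum.
split.
- have h : {in `[0, 1] &, forall y z : R, `|Re (F y) - Re (F z)| <= L * `|y - z|}.
    by move=> y z y1 z1; rewrite -cReB (le_trans (ler_normc_Re _))// FL.
  have -> : Re (power_expectation alpha F) =
      (\int[lebesgue_measure]_(y in `[0%R, 1%R]) (power_density alpha y * Re (F y)))%R.
    by apply: eq_Rintegral => y _; rewrite cReM /= mul0r subr0.
  have := empirical_average_cvg alpha01 L0 h trap_itv freq.
  by apply: cvg_trans; apply: near_eq_cvg; apply: nearW => n; rewrite e.
- have h : {in `[0, 1] &, forall y z : R, `|Im (F y) - Im (F z)| <= L * `|y - z|}.
    by move=> y z y1 z1; rewrite -cImB (le_trans (ler_normc_Im _))// FL.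
  have -> : Im (power_expectation alpha F) =
      (\int[lebesgue_measure]_(y in `[0%R, 1%R]) (power_density alpha y * Im (F y)))%R.
    by apply: eq_Rintegral => y _; rewrite cImM /= mul0r addr0.
  have := empirical_average_cvg alpha01 L0 h trap_itv freq.
  by apply: cvg_trans; apply: near_eq_cvg; apply: nearW => n; rewrite e.
Qed.

(** Elementary form of the mean value inequality, from 1 - c <= exp(- c). *)
Lemma ler_expRN_dist (a b : R) : 0 <= a -> 0 <= b ->
  `|expR (- a) - expR (- b)| <= `|a - b|.
Proof.
wlog ab : a b / a <= b.
  move=> H a0 b0; have [ab|/ltW ba] := leP a b; first exact: H.
  by rewrite distrC [leRHS]distrC H.
move=> a0 b0.
rewrite ger0_norm ?subr_ge0 ?ler_expR ?lerN2// distrC ger0_norm ?subr_ge0//.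
have -> : expR (- b) = expR (- a) * expR (- (b - a)) by rewrite -expRD; congr expR; ring.
rewrite -[X in X - _]mulr1 -mulrBr.
apply: (@le_trans _ _ (1 - expR (- (b - a)))).
  rewrite ler_piMl ?subr_ge0 -?expR0 ?ler_expR ?oppr_le0 ?subr_ge0//.
by have := expR_ge1Dx (- (b - a)); lra.
Qed.

Definition stay_kernel (t : R) (z : R[i]) (y : R) : R[i] :=
  (expR (- (y * t)))%:C / (z - y%:C).

Section fixed_z.
Variables (z : R[i]) (r : R).
Hypothesis r0 : 0 < r.
Hypothesis rz : r <= gap01 z.
Let K := 3 / r.

Lemma normc_subV_le (y : R) : y \in `[0, 1] -> normc (z - y%:C)^-1 <= K.
Proof.
move=> y01; have h := le_trans rz (gap01_le_dist z y01).
have p : 0 < normc (z - y%:C).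
  by have := lt_le_trans r0 h; rewrite pmulr_rgt0.
by rewrite normcV -[leRHS]invrK invf_div lef_pV2 ?posrE ?divr_gt0// ler_pdivrMr// mulrC.
Qed.

Lemma gap01_neq (y : R) : y \in `[0, 1] -> z != y%:C.
Proof.
move=> y01; apply/eqP => zy.
have := lt_le_trans r0 (le_trans rz (gap01_le_dist z y01)).
by rewrite zy subrr Normc.normc0 mulr0 ltxx.
Qed.

Lemma inv_gap_ge0 : 0 <= K. Proof. by rewrite divr_ge0// ltW. Qed.

Lemma normc_stay_kernel t (y : R) : 0 <= t -> y \in `[0, 1] ->
  normc (stay_kernel t z y) <= K.
Proof.
move=> t0 y01; rewrite normcM normcR ger0_norm ?expR_ge0//.
have y0 : 0 <= y by move: y01; rewrite in_itv/= => /andP[].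
rewrite -[leRHS]mul1r; apply: ler_pM; rewrite ?expR_ge0 ?normc_ge0 ?normc_subV_le//.
by rewrite -expR0 ler_expR oppr_le0 mulr_ge0.
Qed.

Lemma stay_kernel_lipschitz t : 0 <= t ->
  {in `[0, 1] &, forall y y' : R,
    normc (stay_kernel t z y - stay_kernel t z y') <= (K * K + t * K) * `|y - y'|}.
Proof.
move=> t0 y y' y01 y01'.
have [yz yz'] : z - y%:C != 0 /\ z - y'%:C != 0 by rewrite !subr_eq0 !gap01_neq.
have [y0 y'0] : 0 <= y /\ 0 <= y'.
  by move: y01 y01'; rewrite !in_itv/= => /andP[-> _] /andP[].
have -> : stay_kernel t z y - stay_kernel t z y' =
   (y - y')%:C * (stay_kernel t z y * (z - y'%:C)^-1) +
   (expR (- (y * t)) - expR (- (y' * t)))%:C * (z - y'%:C)^-1.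
  by rewrite /stay_kernel !rmorphB; field; rewrite yz yz'.
apply: le_trans (ler_normcD _ _) _; rewrite mulrDl; apply: lerD.
  rewrite normcM normcR [leLHS]mulrC ler_wpM2r// normcM.
  apply: ler_pM; rewrite ?normc_ge0//.
    exact: normc_stay_kernel.
  exact: normc_subV_le.
rewrite normcM normcR [leRHS]mulrAC; apply: ler_pM; rewrite ?normc_ge0 ?normc_subV_le//.
apply: le_trans (ler_expRN_dist _ _) _; rewrite ?mulr_ge0//.
by rewrite -mulrBl normrM mulrC ger0_norm.
Qed.

(** The holding rate of a state is x N/(N + 1) and not x, whence a time that
    depends on N; the kernel is Lipschitz in the time, uniformly in the trap. *)
Lemma empirical_kernel_cvg (t : R) (tn : nat -> R) : 0 <= t -> (forall n, 0 <= tn n) ->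
  tn @ \oo --> t ->
  ccvg (fun n => empirical_mean n (stay_kernel (tn n) z))
       (power_expectation alpha (stay_kernel t z)).
Proof.
move=> t0 tn0 tnt.
have L0 : 0 <= K * K + t * K.
  by apply: addr_ge0; apply: mulr_ge0 => //; exact: inv_gap_ge0.
have h1 := empirical_mean_cvg L0 (stay_kernel_lipschitz t0).
have h2 : ccvg (fun n => empirical_mean n (fun y => stay_kernel (tn n) z y - stay_kernel t z y)) 0.
  apply: ccvg_normc0.
  apply: (@squeeze_cvgr _ _ _ _ (cst 0) (fun n => `|tn n - t| * K)).
  - apply: nearW => n; rewrite normc_ge0 subr0 /=.
    apply: normc_empirical_mean => y y01.
    have y0 : 0 <= y <= 1 by move: y01; rewrite in_itv.
    have /andP[y00 y11] := y0.
    rewrite -mulrBl -rmorphB normcM normcR; apply: ler_pM; rewrite ?normc_ge0 ?normc_subV_le//.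
    apply: le_trans (ler_expRN_dist _ _) _; rewrite ?mulr_ge0//.
    by rewrite -mulrBr normrM ler_piMl// ger0_norm.
  - exact: cvg_cst.
  - rewrite -(mul0r K); apply: cvgM; last exact: cvg_cst.
    by rewrite -(normr0 R) -(subrr t); apply: cvg_norm; apply: cvgB => //; exact: cvg_cst.
have := ccvgD h2 h1; rewrite add0r; congr ccvg; apply/funext => n.
by rewrite /empirical_mean -mulrDr -big_split /=; under eq_bigr do rewrite subrK.
Qed.

(** If all the values lie in a half-plane away from 0, so does their mean; [zeta]
    rotates this half-plane to the right one. *)
Lemma empirical_mean_ge n (F : R -> R[i]) (zeta : R[i]) (c : R) :
  normc zeta = 1 -> (forall y : R, y \in `[0, 1] -> c <= Re (zeta * F y)) ->
  c <= normc (empirical_mean n F).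
Proof.
move=> z1 cF; rewrite -[leRHS]mul1r -z1 -normcM.
apply: le_trans (le_trans (ler_norm _) (ler_normc_Re _)).
rewrite /empirical_mean mulrCA mulrC divc_nat /= mulr_sumr cRe_sum.
rewrite ler_pdivlMr ?ltr0n// mulr_natr -[X in _ *+ X]card_ord -sumr_const.
by apply: ler_sum => i _; apply: cF; exact: trap_itv.
Qed.

(** A point off [0, 1] is above, below, to the right or to the left of it, and in
    each case all the 1/(z - y) lie in one half-plane. The bound does not depend on
    the empirical measure, so that it passes to the limit. *)
Lemma empirical_resolvent_ge n (B : R) : normc z <= B ->
  r / 3 / (B + 1) ^+ 2 <= normc (empirical_mean n (fun y => (z - y%:C)^-1)).
Proof.
move=> zB.
have B0 : 0 <= B by apply: le_trans zB; exact: normc_ge0.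
have bound (y p : R) : y \in `[0, 1] -> r / 3 <= p ->
    r / 3 / (B + 1) ^+ 2 <= p / (Re (z - y%:C) ^+ 2 + Im (z - y%:C) ^+ 2).
  move=> y01 rp; set q := Re _ ^+ 2 + _.
  have qE : q = normc (z - y%:C) ^+ 2 by rewrite normc_sqrtE sqr_sqrtr ?addr_ge0 ?sqr_ge0.
  have q0 : 0 < q.
    rewrite lt_neqAle eq_sym addr_sqr_neq0 ?subr_eq0 ?gap01_neq//.
    by rewrite addr_ge0 ?sqr_ge0.
  have qB : q <= (B + 1) ^+ 2.
    rewrite qE lerXn2r ?nnegrE ?normc_ge0 ?addr_ge0//.
    apply: le_trans (ler_normcD _ _) _; rewrite lerD//.
    rewrite normcN normcR; move: y01; rewrite in_itv/= => /andP[y0 y1].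
    by rewrite ger0_norm.
  apply: ler_pM; rewrite ?divr_ge0 ?invr_ge0 ?sqr_ge0//; first exact: ltW.
  by rewrite lef_pV2 ?posrE ?exprn_gt0 // ltr_wpDl.
have i1 : normc ('i : R[i]) = 1 by rewrite normc_sqrtE /= expr0n add0r expr1n sqrtr1.
have Ny y : Re (z - y%:C) = Re z - y /\ Im (z - y%:C) = Im z.
  by rewrite cReB cImB /= subr0.
have : [\/ r / 3 <= Im z, r / 3 <= - Im z | r / 3 <= Re z - 1] \/ r / 3 <= - Re z.
  move: rz; rewrite /gap01.
  (* if all four alternatives fail, the gap is smaller than r *)
  have [h1|h1] := leP (r / 3) (Im z); first by move=> _; left; exact: Or31.
  have [h2|h2] := leP (r / 3) (- Im z); first by move=> _; left; exact: Or32.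
  have [h3|h3] := leP (r / 3) (Re z - 1); first by move=> _; left; exact: Or33.
  have [h4|h4] := leP (r / 3) (- Re z); first by move=> _; right.
  case: (ger0P (Re z)); case: (ger0P (Re z - 1)); case: (ger0P (Im z)); lra.
case=> [[h|h|h]|h].
- apply: (@empirical_mean_ge _ _ ('i) _) => // y y01.
  rewrite cReM cReV cImV /= mul0r mul1r sub0r -mulNr opprK.
  by apply: bound => //; rewrite (Ny y).2.
- apply: (@empirical_mean_ge _ _ (- 'i) _); first by rewrite normcN.
  move=> y y01; rewrite mulNr cReN cReM cReV cImV /= mul0r mul1r sub0r opprK.
  by apply: bound => //; rewrite (Ny y).2.
- apply: (@empirical_mean_ge _ _ (1) _); first exact: Normc.normc1.
  move=> y y01; rewrite mul1r cReV; apply: bound => //; rewrite (Ny y).1.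
  by move: y01; rewrite in_itv/= => /andP[_ y1]; lra.
- apply: (@empirical_mean_ge _ _ (- 1) _); first by rewrite normcN Normc.normc1.
  move=> y y01; rewrite mulN1r cReN cReV -mulNr; apply: bound => //; rewrite (Ny y).1.
  by move: y01; rewrite in_itv/= => /andP[y1 _]; lra.
Qed.

End fixed_z.
End kernel.

(** * Passage to the limit along the loop *)

Section contour.
Context {R : realType}.
Variable g : R -> R[i].
Hypothesis gl : positive_loop_around01 g.
Local Notation D := (`[0, 1]%classic : set R).

Lemma loop_cexp_cbmeas (tw : R) : cbmeas (fun s => cexp (- (tw%:C * g s))).
Proof.
have bg := loop_cbmeas gl; have [_ [M gM]] := bg.
split.
  apply: (@cmeasurable_cvg _ (fun n s => (1 + - tw%:C / n.+1%:R * g s) ^+ n.+1)).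
    move=> n; apply: (cbmeasX n.+1 _).1; apply: cbmeasD; first exact: cbmeas_cst.
    by apply: cbmeasM; [exact: cbmeas_cst|].
  move=> s _.
  have := cexp_lim (- (tw%:C * g s)); congr ccvg; apply/funext => n.
  by congr (_ ^+ _); congr (_ + _); ring.
exists (expR (`|tw| * M)) => s s01; apply: le_trans (cexp_le _) _.
by rewrite ler_expR normcN normcM normcR ler_wpM2l// gM.
Qed.

Variables (x : nat -> R) (t tw : R).
Hypothesis x01 : forall i, 0 < x i <= 1.
Hypothesis t0 : 0 <= t.
Local Notation emp := (empirical_mean x).

(** The time t corrected for the holding rates x N/(N + 1). *)
Definition reduced_time (N : nat) : R := t * (N%:R / N.+1%:R).

Lemma reduced_time_ge0 N : 0 <= reduced_time N.
Proof. by rewrite mulr_ge0 ?divr_ge0. Qed.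

Lemma reduced_time_cvg : reduced_time @ \oo --> t.
Proof.
suff h : (N%:R / N.+1%:R : R) @[N --> \oo] --> (1 : R).
  have : t * (N%:R / N.+1%:R) @[N --> \oo] --> t * 1.
    by apply: cvgM => //; exact: cvg_cst.
  by rewrite mulr1.
have -> : (fun N => N%:R / N.+1%:R : R) = (fun N => 1 - N.+1%:R^-1).
  apply/funext => k; have k0 : k.+1%:R != 0 :> R by rewrite pnatr_eq0.
  by apply: (mulIf k0); rewrite divfK// mulrBl mulVf// mul1r -natr1 addrK.
by have := cvgB (@cvg_cst _ (1 : R) _ _ _) (@cvg_harmonic R); rewrite subr0; apply.
Qed.

Definition contour_integrand (N : nat) (s : R) : R[i] :=
  cexp (- (tw%:C * g s)) / g s *
  (emp N (stay_kernel (reduced_time N) (g s)) / emp N (fun y => (g s - y%:C)^-1)) *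
  cderive g s.

Definition mean_stay (N : nat) : R :=
  let Q := rate_generator (@trap_rate R x N) in
  N.+1%:R^-1 * \sum_a \sum_b expmx (tw *: Q) a b * expR (t * Q b b).

(** The contour formula holds exactly for each N, with the empirical measure in
    place of the power law: both sides are the same combination of the integrals
    evaluated by [loop_cexp_subV]. *)
Lemma mean_stayE N : (mean_stay N)%:C * two_pi_i R = cintegral D (contour_integrand N).
Proof.
pose Q := rate_generator (@trap_rate R x N).
have [l [w [l01 expE resE]]] := trap_semigroup x01 (fun b : 'I_N.+1 => expR (t * Q b b)).
have [r r0 gr] := loop_gap gl.
have [mg [B gB]] := loop_cbmeas gl.
have bd := loop_deriv_cbmeas gl.
have b j : cbmeas (fun s => cexp (- (tw%:C * g s)) * ((g s - (l j)%:C)^-1 * cderive g s)).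
  by apply: cbmeasM; [exact: loop_cexp_cbmeas|apply: cbmeasM; [exact: loop_subV_cbmeas|]].
rewrite /mean_stay expE mulr_suml.
transitivity (cintegral D (fun s => \sum_j w j *
    (cexp (- (tw%:C * g s)) * ((g s - (l j)%:C)^-1 * cderive g s)))).
  rewrite cintegral_sum; last by move=> j; apply: cbmeasM; [exact: cbmeas_cst|].
  by apply: eq_bigr => j _; rewrite cintegralZ// loop_cexp_subV// mulrA.
apply: eq_cintegral => s s01.
have qE (b0 : 'I_N.+1) : t * Q b0 b0 = - (x b0 * reduced_time N).
  rewrite trap_generatorE eqxx mulr1n /reduced_time.
  have k0 : N.+1%:R != 0 :> R by rewrite pnatr_eq0.
  by move: k0; rewrite -natr1 => k0; field.
have G0 : emp N (fun y => (g s - y%:C)^-1) != 0.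
  apply/eqP => e; have := empirical_resolvent_ge x01 r0 (gr s s01) N (gB s s01).
  rewrite e Normc.normc0 leNgt divr_gt0 ?divr_gt0 ?exprn_gt0//.
  by rewrite ltr_wpDl// (le_trans _ (gB s s01)) ?normc_ge0.
have gz y : y \in `[0, 1] -> g s != y%:C by exact: gap01_neq r0 (gr s s01) y.
have := resE _ gz G0.
rewrite /contour_integrand => e.
have -> : emp N (stay_kernel (reduced_time N) (g s)) =
    N.+1%:R^-1 * \sum_(i < N.+1) (expR (t * Q i i))%:C / (g s - (x i)%:C).
  by congr (_ * _); apply: eq_bigr => i _; rewrite qE.
have g0 : g s != 0.
  by rewrite -[0]/(0%:C) gz// in_itv/= lexx ler01.
transitivity (cexp (- (tw%:C * g s)) * (\sum_j w j / (g s - (l j)%:C)) * cderive g s).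
  by rewrite mulr_sumr mulr_suml; apply: eq_bigr => j _; ring.
rewrite -e -/(emp N (fun y => (g s - y%:C)^-1)).
move: (emp N _) G0 => G G0; move: (_ * \sum_(_ < _) _) => H.
by field; rewrite G0 g0.
Qed.

Lemma contour_integrand_cmeasurable N : cmeasurable (contour_integrand N).
Proof.
have bx i : cbmeas (fun s => (g s - (x i)%:C)^-1).
  by apply: loop_subV_cbmeas => //; exact: trap_itv.
have b0 : cbmeas (fun s => (g s)^-1).
  have := @loop_subV_cbmeas _ _ gl 0; rewrite in_itv/= lexx ler01 => /(_ isT).
  by congr cbmeas; apply/funext => s; rewrite subr0.
apply: cmeasurableM; last exact: (loop_deriv_cbmeas gl).1.
apply: cmeasurableM.
  apply: cmeasurableM; last exact: b0.1.
  exact: (loop_cexp_cbmeas tw).1.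
apply: cmeasurableM.
  apply: cmeasurableM; first exact: cmeasurable_cst.
  apply: (cbmeas_sum _ _).1 => i; apply: cbmeasM; [exact: cbmeas_cst|exact: bx].
apply: cmeasurableV; apply: cmeasurableM; first exact: cmeasurable_cst.
by apply: (cbmeas_sum _ _).1 => i; exact: bx.
Qed.

Variable alpha : R.
Hypothesis alpha01 : 0 < alpha < 1.
Hypothesis freq : power_frequencies alpha x.

(** Bounded convergence on the loop: its distance to [0, 1] bounds the numerators
    from above and the denominators from below, uniformly in N. *)
Lemma contour_integrand_cvg :
  ccvg (fun N => cintegral D (contour_integrand N)) (two_pi_i R * limit_Pi alpha g t tw).
Proof.
have pi0 : two_pi_i R != 0.
  by rewrite eq_complex /= eqxx /= mulf_eq0 pnatr_eq0 /=; exact/lt0r_neq0/pi_gt0.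
rewrite /limit_Pi mulVKf//.
have [r r0 gr] := loop_gap gl.
have [mg [B gB]] := loop_cbmeas gl.
have [_ [B' dB]] := loop_deriv_cbmeas gl.
have [_ [B2 eB]] := loop_cexp_cbmeas tw.
pose c := r / 3 / (B + 1) ^+ 2.
have z01 : 0 \in (`[0, 1] : interval R) by rewrite in_itv/= lexx ler01.
have B0 : 0 <= B by apply: le_trans (gB 0 z01); exact: normc_ge0.
have c0 : 0 < c by rewrite divr_gt0 ?divr_gt0 ?exprn_gt0// ltr_wpDl.
apply: (@cintegral_bounded_cvg _ _ _ (B2 * (3 / r) * ((3 / r) * c^-1) * B')).
- exact: contour_integrand_cmeasurable.
- move=> N s s01; rewrite /contour_integrand normcM; apply: ler_pM; rewrite ?normc_ge0 ?dB//.
  rewrite normcM; apply: ler_pM; rewrite ?normc_ge0//.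
    rewrite normcM; apply: ler_pM; rewrite ?normc_ge0 ?eB//.
    by have := normc_subV_le r0 (gr s s01) z01; rewrite subr0.
  rewrite normcM; apply: ler_pM; rewrite ?normc_ge0//.
    apply: (normc_empirical_mean x01) => y y01.
    exact: (normc_stay_kernel r0 (gr s s01) (reduced_time_ge0 N) y01).
  have ce := empirical_resolvent_ge x01 r0 (gr s s01) N (gB s s01).
  by rewrite normcV lef_pV2 ?posrE// (lt_le_trans c0 ce).
move=> s s01.
have inv0 : (fun y => (g s - y%:C)^-1) = stay_kernel 0 (g s).
  by apply/funext => y; rewrite /stay_kernel mulr0 oppr0 expR0 mul1r.
have zero_cvg : (fun _ : nat => 0 : R) @ \oo --> (0 : R) by exact: cvg_cst.
have k0 := empirical_kernel_cvg alpha01 x01 freq r0 (gr s s01) (lexx 0) (fun=> lexx 0) zero_cvg.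
have k1 := empirical_kernel_cvg alpha01 x01 freq r0 (gr s s01) t0 reduced_time_ge0 reduced_time_cvg.
rewrite -inv0 in k0.
apply: ccvgM; last exact: ccvg_cst.
apply: ccvgM; first exact: ccvg_cst.
apply: ccvgM; first exact: k1.
apply: ccvgV; last exact: k0.
have h : c <= normc (power_expectation alpha (fun y => (g s - y%:C)^-1)).
  apply: (cvgr_to_ge (ccvg_normc k0)); apply: nearW => n.
  exact: (empirical_resolvent_ge x01 r0 (gr s s01) n (gB s s01)).
apply/eqP => e; move: h; rewrite e Normc.normc0 leNgt c0//.
Qed.

Lemma mean_stay_cvg :
  (fun N => (mean_stay N)%:C : R[i]^o) @ \oo --> (limit_Pi alpha g t tw : R[i]^o).
Proof.
have pi0 : two_pi_i R != 0.
  by rewrite eq_complex /= eqxx /= mulf_eq0 pnatr_eq0 /=; exact/lt0r_neq0/pi_gt0.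
have h : ccvg (fun N => (mean_stay N)%:C) (limit_Pi alpha g t tw).
  have := ccvgM (ccvg_cst (two_pi_i R)^-1) contour_integrand_cvg.
  rewrite mulKf//; congr ccvg; apply/funext => N.
  by rewrite -mean_stayE mulrC mulfK.
by apply: cvgC_ReIm; case: h.
Qed.

End contour.

Theorem proposition2p5 (R : realType) (alpha : R)
    (d : measure_display) (T : measurableType d) (P : probability T R)
    (E : nat -> {RV P >-> R}) :
  0 < alpha < 1 ->
  mutually_independent E ->
  (forall (i : nat) (A : set R), measurable A ->
     distribution P (E i) A = exponential_prob alpha A) ->
  {ae P, forall w : T,
    forall (d' : nat -> measure_display)
           (T' : forall N : nat, measurableType (d' N))
           (PN : forall N : nat, probability (T' N) R)
           (Y : forall N : nat, R -> T' N -> 'I_N.+1),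
      (forall N : nat,
         is_markov_chain (PN N) (@uniform_law R N)
           (@trap_rate R (fun i => expR (- E i w)) N) (Y N)) ->
      forall g : R -> R[i], positive_loop_around01 g ->
      forall t tw : R, 0 <= t -> 0 <= tw ->
        (fun N : nat => (stay_probability (PN N) (Y N) t tw)%:C : R[i]^o) @ \oo
          --> (limit_Pi alpha g t tw : R[i]^o)}.
Proof.
move=> alpha01 Eind Eexp.
have := ae_traps Eind Eexp; apply: filterS => w [x01 freq] d' T' PN Y MC g gl t tw t0 tw0.
have <- : (fun N : nat => (mean_stay (fun i => expR (- E i w)) t tw N)%:C : R[i]^o) =
    (fun N : nat => (stay_probability (PN N) (Y N) t tw)%:C : R[i]^o).
  apply/funext => N; congr (_%:C).
  have u0 (i : 'I_N.+1) : 0 < uniform_law R i by rewrite /uniform_law invr_gt0.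
  have [V [l [Vu l01 QV]]] := trap_generator_spectral N x01.
  rewrite (stay_probabilityE u0 (MC N) t0 tw0); last first.
    by move=> i; exact: expmx_diag_derivative Vu QV t i.
  rewrite /mean_stay exchange_big /= mulr_sumr; apply: eq_bigr => b _.
  by rewrite mulr_sumr.
exact: mean_stay_cvg.
Qed.
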